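(* Let $k\ge 2$ be an integer, let $G = B(P_{3,k}) = \langle w_0,w_1,w_2 \mid [w_0,w_1^k]=1,\ [w_0,w_2]=1\rangle$, and let $\Gamma$ be any finite undirected graph. Then $G$ contains the right-angled Artin group $A(\Gamma)$ as a subgroup (up to isomorphism) if and only if $\Gamma$ is a forest.
   Context: $\langle A \mid R\rangle$ denotes the group presented by generators $A$ and defining relations $R$; $[x,y]=xyx^{-1}y^{-1}$. Graphs $\Gamma$ here are simple (no loops or multiple edges). $P_{3,k}$ is the edge-labelled graph on the vertices $w_0,w_1,w_2$ with a directed edge labelled $k$ from $w_0$ to $w_1$ (giving the relation $[w_0,w_1^k]=1$) and an undirected edge between $w_0$ and $w_2$ (giving the relation $[w_0,w_2]=1$). For a finite undirected graph $\Gamma$ with vertices $x_1,\dots,x_n$ and edge set $E$, the right-angled Artin group is $A(\Gamma)=\langle x_1,\dots,x_n \mid [x_i,x_j]=1 \text{ whenever } (x_i,x_j)\in E\rangle$. *)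

(* Defs.v *)
From HB Require Import structures.
From mathcomp Require Import all_boot.
From mathcomp Require Import boolp.

Set Implicit Arguments.
Unset Strict Implicit.
Unset Printing Implicit Defensive.

Local Open Scope quotient_scope.

(* The letter (a, false) stands for the generator a, and (a, true) for its
   inverse. *)
Definition word (A : Type) : Type := seq (A * bool).

Definition letter (A : Type) (a : A) : word A := [:: (a, false)].

Definition letter_exp (A : Type) (a : A) (n : nat) : word A := nseq n (a, false).

Definition inv_word (A : Type) (u : word A) : word A :=
  rev [seq (l.1, ~~ l.2) | l <- u].

(* [u, v] = u v u^-1 v^-1; the library's [~ x, y] is x^-1 y^-1 x y. *)
Definition comm_word (A : Type) (u v : word A) : word A :=
  u ++ v ++ inv_word u ++ inv_word v.

(* The congruence on words generated by free cancellation and by R r = 1 for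
   the relators r: its classes are the cosets of the normal closure of R in the
   free group on A. *)
Inductive pres_eq (A : Type) (R : word A -> Prop) : word A -> word A -> Prop :=
| pres_eq_refl u : pres_eq R u u
| pres_eq_sym u v : pres_eq R u v -> pres_eq R v u
| pres_eq_trans u v w : pres_eq R u v -> pres_eq R v w -> pres_eq R u w
| pres_eq_cat u u' v v' :
    pres_eq R u u' -> pres_eq R v v' -> pres_eq R (u ++ v) (u' ++ v')
| pres_eq_cancel a b : pres_eq R [:: (a, b); (a, ~~ b)] [::]
| pres_eq_relator r : R r -> pres_eq R r [::].

Section PresentedGroup.
Variables (A : choiceType) (R : word A -> Prop).

Definition pres_eqb : rel (seq (A * bool)) := fun u v => `[< pres_eq R u v >].

Fact pres_eqb_refl : reflexive pres_eqb.
Proof. by move=> u; apply/asboolP; exact: pres_eq_refl. Qed.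

Fact pres_eqb_sym : symmetric pres_eqb.
Proof. by move=> u v; apply: asbool_equiv_eq; split; exact: pres_eq_sym. Qed.

Fact pres_eqb_trans : transitive pres_eqb.
Proof.
move=> v u w /asboolP uv /asboolP vw; apply/asboolP.
exact: pres_eq_trans uv vw.
Qed.

Canonical pres_equiv :=
  EquivRel pres_eqb pres_eqb_refl pres_eqb_sym pres_eqb_trans.

Definition presented : Type := {eq_quot pres_equiv}.
HB.instance Definition _ : EqQuotient _ pres_equiv presented :=
  EqQuotient.on presented.
HB.instance Definition _ := Choice.on presented.

Definition pres_class (u : word A) : presented := \pi_presented u.

Lemma pres_classP u v : pres_class u = pres_class v <-> pres_eq R u v.
Proof.
split=> [/eqP|uv]; first by rewrite eqmodE => /asboolP.
by apply/eqP; rewrite eqmodE; apply/asboolP.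
Qed.

Lemma pres_class_repr (x : presented) : pres_class (repr x) = x.
Proof. exact: reprK. Qed.

Lemma pres_eq_repr u : pres_eq R (repr (pres_class u)) u.
Proof. by apply/pres_classP; rewrite pres_class_repr. Qed.

Lemma inv_word_cat (u v : word A) :
  inv_word (u ++ v) = inv_word v ++ inv_word u.
Proof. by rewrite /inv_word map_cat rev_cat. Qed.

Lemma inv_wordK : involutive (@inv_word A).
Proof.
move=> u; rewrite /inv_word map_rev revK -map_comp -[RHS]map_id.
by apply: eq_map => -[a b] /=; rewrite negbK.
Qed.

Lemma pres_eq_mulV (u : word A) : pres_eq R (u ++ inv_word u) [::].
Proof.
elim: u => [|[a b] u IHu]; first exact: pres_eq_refl.
apply: pres_eq_trans (pres_eq_cancel R a b).
rewrite -[_ :: u]cat1s inv_word_cat -catA (catA u).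
rewrite -[X in pres_eq _ _ X]/([:: (a, b)] ++ [::] ++ inv_word [:: (a, b)]).
apply: pres_eq_cat (pres_eq_refl _ _) _.
exact: pres_eq_cat IHu (pres_eq_refl _ _).
Qed.

Lemma pres_eq_inv (u v : word A) :
  pres_eq R u v -> pres_eq R (inv_word u) (inv_word v).
Proof.
move=> uv; pose refl := @pres_eq_refl A R.
apply: (@pres_eq_trans _ _ _ (inv_word u ++ v ++ inv_word v)).
  rewrite -[X in pres_eq _ X _]cats0; apply: pres_eq_cat (refl _) _.
  exact: pres_eq_sym (pres_eq_mulV v).
rewrite catA -[X in pres_eq _ _ X]cat0s; apply: pres_eq_cat (refl _).
apply: (@pres_eq_trans _ _ _ (inv_word u ++ u)).
  by apply: pres_eq_cat (refl _) (pres_eq_sym uv).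
by rewrite -{2}(inv_wordK u); exact: pres_eq_mulV.
Qed.

Definition pres_mul (x y : presented) : presented :=
  pres_class (repr x ++ repr y).
Definition pres_one : presented := pres_class [::].
Definition pres_inv (x : presented) : presented :=
  pres_class (inv_word (repr x)).

Lemma pres_mulE u v : pres_mul (pres_class u) (pres_class v) = pres_class (u ++ v).
Proof. by apply/pres_classP; apply: pres_eq_cat; exact: pres_eq_repr. Qed.

Lemma pres_invE u : pres_inv (pres_class u) = pres_class (inv_word u).
Proof. by apply/pres_classP; apply: pres_eq_inv; exact: pres_eq_repr. Qed.

Fact pres_mulA : associative pres_mul.
Proof.
move=> x y z.
rewrite -(pres_class_repr x) -(pres_class_repr y) -(pres_class_repr z).
by rewrite !pres_mulE catA.
Qed.

Fact pres_mul1 : left_id pres_one pres_mul.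
Proof. by move=> x; rewrite -(pres_class_repr x) pres_mulE. Qed.

Fact pres_mulr1 : right_id pres_one pres_mul.
Proof. by move=> x; rewrite -(pres_class_repr x) pres_mulE cats0. Qed.

Fact pres_mulV : left_inverse pres_one pres_inv pres_mul.
Proof.
move=> x; rewrite -(pres_class_repr x) pres_invE pres_mulE.
by apply/pres_classP; rewrite -{2}(inv_wordK (repr x)); exact: pres_eq_mulV.
Qed.

Fact pres_mulrV : right_inverse pres_one pres_inv pres_mul.
Proof.
move=> x; rewrite -(pres_class_repr x) pres_invE pres_mulE.
by apply/pres_classP; exact: pres_eq_mulV.
Qed.

HB.instance Definition _ :=
  isGroup.Build presented pres_mulA pres_mul1 pres_mulr1 pres_mulV pres_mulrV.

End PresentedGroup.

Definition raag_relators (V : Type) (e : rel V) (r : word V) : Prop :=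
  exists x y : V, e x y /\ r = comm_word (letter x) (letter y).

Definition raag (V : finType) (e : rel V) : groupType :=
  presented (raag_relators e).

Definition w0 : 'I_3 := @Ordinal 3 0 isT.
Definition w1 : 'I_3 := @Ordinal 3 1 isT.
Definition w2 : 'I_3 := @Ordinal 3 2 isT.

Definition BP3_relators (k : nat) (r : word 'I_3) : Prop :=
  r = comm_word (letter w0) (letter_exp w1 k)
  \/ r = comm_word (letter w0) (letter w2).

Definition BP3 (k : nat) : groupType := presented (BP3_relators k).

Definition embeds_in (H G : groupType) : Prop :=
  exists f : {multiplicative H -> G}, injective f.

(* For symmetric irreflexive e, the duplicate-free e-cycles of size 2 are the
   edges, traversed back and forth; those of size at least 3 are the cycles of
   the graph. *)
Definition is_forest (V : finType) (e : rel V) : Prop :=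
  forall c : seq V, ucycle e c -> size c <= 2.

(* Main.v *)
Require Import Defs.
From HB Require Import structures.
From mathcomp Require Import all_boot all_order all_algebra.
From mathcomp Require Import boolp.
From mathcomp Require Import zify lra.

(** Write [a], [b], [c] for the generators [w0], [w1], [w2] of [G = BP3 k].

    If [raag e] embeds in [G], then [e] is a forest.  The homomorphism [G -> Z]
    that sends [a] and [b] to 1 and [c] to 0 has a free kernel: the conjugates
    [al i] of [a b^-1] by [b^i] for [i < k], together with [c], are a basis,
    and conjugation by [b] permutes the [al i] cyclically and sends [c] to
    [(al 0)^-1 c (al 0)] (lemma [BP3_free_by_cyclic]).  Hence a subgroup of [G]
    carries a height function to the integers whose kernel is free
    ([free_by_cyclic]), and a right-angled Artin group with that property has no
    cycle ([free_by_cyclic_forest]):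
    - a triangle gives [Z^3], hence two independent commuting elements of the
      kernel, while commuting elements of a free group have a common power;
    - in a shortest cycle [x 0, ..., x n] of length at least four, [x i] and
      [x (i + 2)] are not adjacent.  No [x i] has height 0, because commutation
      is transitive in the kernel on nontrivial elements.  So there are powers
      [y i] of the [x i] which all have the same height, and the elements
      [z i = y i (y (i + 1))^-1] are in the kernel.  For every [m] the product of
      the [z i ^ m] telescopes to 1, although consecutive [z i] do not commute.
      In a free group this is impossible for large [m] ([big_powers]), since
      high powers of elements with distinct axes in the Cayley tree cannot
      cancel much.

    Conversely, let [e] be a forest.  The elements [c], [a], [b^k], [b^-1 a b]
    generate a right-angled Artin group on a path with four vertices, which is
    the corona of an edge: the edge with a pendant vertex at both ends
    ([corona_edge_embeds]).  The group of a graph contains that of any finite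
    piece of the cover obtained by gluing infinitely many copies of the graph
    minus a vertex along the link of that vertex ([star_cover]).  Applied to the
    pendant vertex at [x] in the corona of a graph, this yields the corona of the
    same graph with one more leaf at [x] ([corona_add_leaf]), as long as [x] is
    not isolated.  By adding leaves one obtains graphs that contain [e] as an
    induced subgraph ([forest_in_corona_embeds]).

    A homomorphism between presented groups is seen to be injective from an action
    of its target on a set that contains a copy of its source
    ([embedding_by_action]). *)

Set Implicit Arguments.
Unset Strict Implicit.
Unset Printing Implicit Defensive.

Import GRing.Theory.
Local Open Scope group_scope.

(** * Integer powers in a group *)

Section IntegerPowers.
Variable G : groupType.
Implicit Types (x y : G) (n : int).

Definition zpow x n : G :=
  match n with Posz m => x ^+ m | Negz m => x ^- m.+1 end.

Lemma zpowV x n : zpow x (- n)%R = (zpow x n)^-1.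
Proof.
case: n => [[|n]|n]; first by rewrite /= invg1.
- by rewrite -NegzE.
- by rewrite NegzE opprK /= invgK.
Qed.

Lemma zpowS x n : zpow x (n + 1)%R = x * zpow x n.
Proof.
case: n => [n|[|n]]; first by rewrite -PoszD addn1 -expgS.
  by rewrite /= mulgV.
rewrite (_ : (Negz n.+1 + 1)%R = Negz n); last by lia.
by rewrite /= [in RHS]expgSr invgM mulVKg.
Qed.

Lemma zpowP x n : zpow x (n - 1)%R = x^-1 * zpow x n.
Proof. by rewrite -{2}(subrK 1%R n) zpowS mulKg. Qed.

Lemma commute_zpow x y m n : commute x y -> commute (zpow x m) (zpow y n).
Proof.
have one a b k : commute a b -> commute a (zpow b k).
  by move=> ab; case: k => k /=; [|apply: commuteV]; apply: commuteX.
by move=> xy; apply/one/commute_sym/one/commute_sym.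
Qed.

Lemma commute_conj g x y : commute x y -> commute (g * x * g^-1) (g * y * g^-1).
Proof.
by rewrite /commute => xy; rewrite !mulgA !mulgVK -(mulgA g) xy !mulgA.
Qed.

End IntegerPowers.

(** * Iterating a bijection over the integers *)

Section IntegerIteration.
Variables (T : Type) (f g : T -> T).
Hypotheses (fK : cancel f g) (gK : cancel g f).

Definition ziter (n : int) (x : T) : T :=
  match n with Posz m => iter m f x | Negz m => iter m.+1 g x end.

Lemma ziterS n x : ziter (n + 1)%R x = f (ziter n x).
Proof.
case: n => [n|[|n]]; first by rewrite -PoszD addn1.
  by rewrite /= gK.
rewrite (_ : (Negz n.+1 + 1)%R = Negz n); last by lia.
by rewrite /= gK.
Qed.

Lemma ziterP n x : ziter (n - 1)%R x = g (ziter n x).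
Proof. by rewrite -{2}(subrK 1%R n) ziterS fK. Qed.

End IntegerIteration.

(** * Homomorphisms and actions of presented groups *)

Lemma multiplicative_of (G H : groupType) (f : G -> H) :
  {morph f : x y / x * y} -> exists g : {multiplicative G -> H}, g =1 f.
Proof.
move=> fM.
pose m := isMultiplicative.Build G H f fM.
pose F : {multiplicative G -> H} := HB.pack f m.
by exists F.
Qed.

Lemma morph_one (G H : groupType) (f : G -> H) :
  {morph f : x y / x * y} -> f 1 = 1.
Proof. by move=> fM; apply: (@mulgI _ (f 1)); rewrite -fM !mulg1. Qed.

Lemma morph_inv (G H : groupType) (f : G -> H) :
  {morph f : x y / x * y} -> {morph f : x / x^-1}.
Proof.
by move=> fM x; apply/esym/mulg1_eq; rewrite -fM mulgV morph_one.
Qed.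

Lemma embeds_in_trans (G H K : groupType) :
  embeds_in G H -> embeds_in H K -> embeds_in G K.
Proof.
case=> f fI [g gI].
have [h hE] : exists h : {multiplicative G -> K}, h =1 g \o f.
  by apply: multiplicative_of => x y /=; rewrite !gmulfM.
by exists h => x y; rewrite !hE => /gI/fI.
Qed.

Section Eval.
Variables (A : choiceType) (R : word A -> Prop).

Lemma pres_classM u w :
  pres_class R u * pres_class R w = pres_class R (u ++ w).
Proof. exact: pres_mulE. Qed.

Lemma pres_classV u : (pres_class R u)^-1 = pres_class R (inv_word u).
Proof. exact: pres_invE. Qed.

Definition gen (a : A) : presented R := pres_class R (letter a).

Section Values.
Variables (H : groupType) (v : A -> H).

Definition eval (w : word A) : H :=
  \prod_(l <- w) (if l.2 then (v l.1)^-1 else v l.1).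

Lemma eval_cat u w : eval (u ++ w) = eval u * eval w.
Proof. exact: big_cat. Qed.

Lemma eval_letter a : eval (letter a) = v a.
Proof. exact: big_seq1. Qed.

Lemma eval_inv u : eval (inv_word u) = (eval u)^-1.
Proof.
elim: u => [|[a b] u IHu]; first by rewrite /eval !big_nil invg1.
rewrite -cat1s inv_word_cat !eval_cat IHu invgM; congr (_ * _).
by rewrite /eval !big_seq1 /=; case: b => //=; rewrite invgK.
Qed.

Lemma eval_exp a n : eval (letter_exp a n) = v a ^+ n.
Proof.
elim: n => [|n IHn]; first exact: big_nil.
by rewrite /eval big_cons /= -/(eval _) IHn expgS.
Qed.

Lemma eval_comm u w : eval (comm_word u w) = 1 <-> commute (eval u) (eval w).
Proof.
rewrite /comm_word !eval_cat !eval_inv mulgA mulgA -mulgA -invgM.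
by split=> [/divg1_eq|->]; rewrite ?mulgV.
Qed.

Hypothesis vR : forall r, R r -> eval r = 1.

Lemma pres_eq_eval u w : pres_eq R u w -> eval u = eval w.
Proof.
elim=> // [x y z _ -> _ -> //|x x' y y' _ xx' _ yy'|a b|r /vR ->].
- by rewrite !eval_cat xx' yy'.
- by rewrite /eval big_cons big_seq1 big_nil /=; case: b; rewrite ?mulgV ?mulVg.
- by rewrite /eval big_nil.
Qed.

Definition pres_lift (x : presented R) : H := eval (repr x).

Lemma pres_lift_class w : pres_lift (pres_class R w) = eval w.
Proof. exact/pres_eq_eval/pres_eq_repr. Qed.

Lemma pres_liftM : {morph pres_lift : x y / x * y}.
Proof.
move=> x y; rewrite -(pres_class_repr x) -(pres_class_repr y).
by rewrite pres_classM !pres_lift_class eval_cat.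
Qed.

Lemma pres_lift_gen a : pres_lift (gen a) = v a.
Proof. by rewrite pres_lift_class eval_letter. Qed.

End Values.

Lemma eval_gen w : eval gen w = pres_class R w.
Proof.
elim: w => [|[a b] w IHw]; first exact: big_nil.
rewrite -cat1s eval_cat IHw -pres_classM; congr (_ * _).
by rewrite /eval big_seq1 /=; case: b; rewrite // /gen pres_classV.
Qed.

Lemma gen_relator r : R r -> eval gen r = 1.
Proof. by move=> Rr; rewrite eval_gen; apply/pres_classP/pres_eq_relator. Qed.

Lemma pres_ind (P : presented R -> Prop) : (forall w, P (eval gen w)) ->
  forall x, P x.
Proof. by move=> Pw x; rewrite -(pres_class_repr x) -eval_gen. Qed.

Lemma morph_eq_gen (H : groupType) (f g : presented R -> H) :
  {morph f : x y / x * y} -> {morph g : x y / x * y} ->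
  (forall a, f (gen a) = g (gen a)) -> f =1 g.
Proof.
move=> fM gM fg; apply: pres_ind; elim=> [|[a b] w IHw].
  by rewrite /eval big_nil !morph_one.
rewrite -cat1s eval_cat fM gM IHw; congr (_ * _).
by rewrite /eval big_seq1; case: b; rewrite /= ?(morph_inv fM) ?(morph_inv gM) fg.
Qed.

Section ExponentSum.
Variable wt : A -> int.

Definition exponent_sum (w : word A) : int :=
  (\sum_(l <- w) if l.2 then - wt l.1 else wt l.1)%R.

Lemma exponent_sum_cat u w :
  exponent_sum (u ++ w) = (exponent_sum u + exponent_sum w)%R.
Proof. exact: big_cat. Qed.

Lemma exponent_sum_inv u : exponent_sum (inv_word u) = (- exponent_sum u)%R.
Proof.
rewrite /exponent_sum /inv_word big_rev big_map -sumrN; apply: eq_bigr => l _ /=.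
by case: l.2; rewrite ?opprK.
Qed.

Lemma exponent_sum_comm u w : exponent_sum (comm_word u w) = 0%R.
Proof. by rewrite !exponent_sum_cat !exponent_sum_inv; lia. Qed.

Hypothesis wtR : forall r, R r -> exponent_sum r = 0%R.

Lemma pres_eq_exponent_sum u w :
  pres_eq R u w -> exponent_sum u = exponent_sum w.
Proof.
elim=> // [x y z _ -> _ -> //|x x' y y' _ xx' _ yy'|a b|r /wtR ->].
- by rewrite !exponent_sum_cat xx' yy'.
- by rewrite /exponent_sum big_cons big_seq1 big_nil /=; case: b => /=; lia.
- by rewrite /exponent_sum big_nil.
Qed.

Definition pdeg (x : presented R) : int := exponent_sum (repr x).

Lemma pdeg_class w : pdeg (pres_class R w) = exponent_sum w.
Proof. exact/pres_eq_exponent_sum/pres_eq_repr. Qed.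

Lemma pdegM x y : pdeg (x * y) = (pdeg x + pdeg y)%R.
Proof.
rewrite -(pres_class_repr x) -(pres_class_repr y).
by rewrite pres_classM !pdeg_class exponent_sum_cat.
Qed.

Lemma pdeg_gen a : pdeg (gen a) = wt a.
Proof. by rewrite pdeg_class /exponent_sum big_seq1. Qed.

End ExponentSum.

Section Actions.
Variables (S : Type) (act : A * bool -> S -> S).

Definition wact (w : word A) (s : S) : S := foldr act s w.

Lemma wact_cat u w s : wact (u ++ w) s = wact u (wact w s).
Proof. exact: foldr_cat. Qed.

Hypothesis actK : forall a b s, act (a, b) (act (a, ~~ b) s) = s.

Lemma wact_invK u s : wact (inv_word u) (wact u s) = s.
Proof.
elim: u => [|[a b] u IHu] //=.
by rewrite -cat1s inv_word_cat wact_cat /= -{2}[b]negbK actK.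
Qed.

Lemma wactK_inv u s : wact u (wact (inv_word u) s) = s.
Proof. by rewrite -{1}(inv_wordK u) wact_invK. Qed.

Lemma wact_comm u w :
  (forall s, wact u (wact w s) = wact w (wact u s)) ->
  forall s, wact (comm_word u w) s = s.
Proof.
by move=> uw s; rewrite /comm_word !wact_cat uw !wactK_inv.
Qed.

Hypothesis actR : forall r, R r -> forall s, wact r s = s.

Lemma pres_eq_wact u w : pres_eq R u w -> forall s, wact u s = wact w s.
Proof.
elim=> // [x y z _ xy _ yz s|x x' y y' _ xx' _ yy' s].
  by rewrite xy.
by rewrite !wact_cat xx' yy'.
Qed.

Definition pact (x : presented R) (s : S) : S := wact (repr x) s.

Lemma pact_class w s : pact (pres_class R w) s = wact w s.
Proof. exact/pres_eq_wact/pres_eq_repr. Qed.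

Lemma pactM x y s : pact (x * y) s = pact x (pact y s).
Proof.
rewrite -(pres_class_repr x) -(pres_class_repr y).
by rewrite pres_classM !pact_class wact_cat.
Qed.

Lemma pact1 s : pact 1 s = s.
Proof. exact: (pact_class [::]). Qed.

Lemma pactK x : cancel (pact x) (pact x^-1).
Proof. by move=> s; rewrite -pactM mulVg pact1. Qed.

Lemma pact_gen a s : pact (gen a) s = act (a, false) s.
Proof. exact: pact_class. Qed.

Lemma pact_genV a s : pact (gen a)^-1 s = act (a, true) s.
Proof. by rewrite /gen pres_classV pact_class. Qed.

End Actions.
End Eval.

(** The image of [x] moves [i 1] to [i x], hence determines [x]. As it is enough to
    check that the relators of the target act trivially, no normal form for the
    target is needed. *)
Lemma embedding_by_action (A B : choiceType) (R : word A -> Prop)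
    (Q : word B -> Prop) (v : A -> presented Q)
    (S : Type) (act : B * bool -> S -> S) (i : presented R -> S) :
    injective i ->
    (forall r, R r -> eval v r = 1) ->
    (forall b s x, act (b, s) (act (b, ~~ s) x) = x) ->
    (forall r, Q r -> forall s, wact act r s = s) ->
    (forall a x, pact act (v a) (i x) = i (gen R a * x)) ->
  embeds_in (presented R) (presented Q).
Proof.
move=> iI vR actK actQ vE.
have [f fE] := multiplicative_of (pres_liftM vR).
exists f => x y; rewrite !fE => fxy; apply: iI.
suff act1 z : pact act (pres_lift v z) (i 1) = i z.
  by rewrite -(act1 x) -(act1 y) fxy.
move: z; apply: pres_ind => w; rewrite eval_gen pres_lift_class // -eval_gen.
elim: w => [|[a b] w IHw]; first by rewrite /eval !big_nil pact1.
rewrite -cat1s !eval_cat pactM // IHw /eval !big_seq1 /=; case: b => //.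
apply: (can_inj (pactK actK actQ (v a))).
by rewrite -pactM // mulgV vE pact1 ?mulVKg.
Qed.

(** * Reduced words in a free group *)

Lemma take_size_add (T : Type) (s t : seq T) i :
  take (size s + i) (s ++ t) = s ++ take i t.
Proof. by rewrite take_cat ltnNge leq_addr /= addKn. Qed.

Lemma take_leq_eq (T : Type) (s t : seq T) m n : m <= n ->
  take n s = take n t -> take m s = take m t.
Proof. by move=> mn st; rewrite -(take_takel s mn) st take_takel. Qed.

Lemma common_prefix (T : eqType) (s t : seq T) : exists q s' t',
  [/\ s = q ++ s', t = q ++ t' &
      if (s', t') is (a :: _, b :: _) then a != b else true].
Proof.
elim: s t => [|a s IHs] [|b t]; try by exists [::]; do 2!eexists.
have [<-{b}|ab] := eqVneq a b; last by exists [::], (a :: s), (b :: t).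
by have [q [s' [t' [-> -> st]]]] := IHs t; exists (a :: q), s', t'.
Qed.

Section ReducedWords.
Variable A : choiceType.
Implicit Types (l a b : A * bool) (u v w : word A).

Definition linv l : A * bool := (l.1, ~~ l.2).

Lemma linvK : involutive linv.
Proof. by case=> a b; rewrite /linv negbK. Qed.

Lemma linv_neq l : l != linv l.
Proof.
by case: l => a b; rewrite xpair_eqE negb_and /=; case: b; rewrite orbT.
Qed.

Definition reduced w : bool := sorted (fun a b => b != linv a) w.

Lemma reduced_cat_cons u a v :
  reduced (u ++ a :: v) = reduced (rcons u a) && reduced (a :: v).
Proof.
case: u => [|b u] //=.
by rewrite cat_path rcons_path /= -!andbA.
Qed.

Lemma reduced_rcons_cat u b a v :
  reduced (rcons u b ++ a :: v) =
    [&& reduced (rcons u b), a != linv b & reduced (a :: v)].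
Proof. by rewrite cat_rcons reduced_cat_cons. Qed.

Lemma reduced_overlap u v w : v != [::] ->
  reduced (u ++ v) -> reduced (v ++ w) -> reduced (u ++ v ++ w).
Proof.
case: v => // a v _; rewrite !cat_cons !(reduced_cat_cons u).
by case/andP=> -> _ ->.
Qed.

Lemma reduced_catl u v : reduced (u ++ v) -> reduced u.
Proof. by case: u => //= a u; rewrite cat_path => /andP[]. Qed.

Lemma reduced_catr u v : reduced (u ++ v) -> reduced v.
Proof.
by case: v => // a v; rewrite reduced_cat_cons => /andP[].
Qed.

Lemma inv_word_cons a u : inv_word (a :: u) = rcons (inv_word u) (linv a).
Proof. by rewrite /inv_word /= rev_cons. Qed.

Lemma size_inv_word u : size (inv_word u) = size u.
Proof. by rewrite /inv_word size_rev size_map. Qed.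

Lemma reduced_inv u : reduced (inv_word u) = reduced u.
Proof.
rewrite /reduced /inv_word rev_sorted sorted_map.
apply: eq_sorted => a b /=; rewrite /linv /= [in RHS]eq_sym.
by case: a b => [a p] [b q]; rewrite !xpair_eqE /= eq_sym; case: p; case: q.
Qed.

Definition push l w : word A :=
  if w is l' :: w' then if l' == linv l then w' else l :: w else [:: l].

Lemma push_reduced l w : reduced w -> reduced (push l w).
Proof.
case: w => [|l' w] //= redw; case: ifPn => [_|ne]; last by rewrite /= ne.
by case: w redw => //= b w /andP[].
Qed.

Lemma pushK l w : reduced w -> push l (push (linv l) w) = w.
Proof.
case: w => [|a w] /=; first by rewrite eqxx.
rewrite linvK; case: eqVneq => [->|_] redw; last by rewrite /= eqxx.
by case: w redw => [|b w] //= /andP[/negbTE->].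
Qed.

Definition nf w : word A := foldr push [::] w.

Lemma nf_reduced w : reduced (nf w).
Proof. by elim: w => //= l w; apply: push_reduced. Qed.

Lemma nf_id w : reduced w -> nf w = w.
Proof.
elim: w => // a w IHw redw; rewrite /= IHw; last exact: (@reduced_catr [:: a]).
by case: w redw {IHw} => //= b w /andP[/negbTE->].
Qed.

Lemma size_push l w : size (push l w) <= (size w).+1.
Proof. by case: w => //= a w; case: ifP => // _; apply/leqW/leqW. Qed.

Lemma size_nf w : size (nf w) <= size w.
Proof. by elim: w => //= l w IHw; apply: leq_trans (size_push _ _) _. Qed.

(** Each cancellation shortens a word. *)
Lemma size_nf_reduced w : size (nf w) = size w -> reduced w.
Proof.
elim: w => // l w IHw /= sz.
have szw : size (nf w) = size w.
  by apply/eqP; rewrite eqn_leq size_nf -ltnS -sz size_push.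
have redw := IHw szw; move: sz; rewrite (nf_id redw).
case: w redw {IHw szw} => //= a w ->; rewrite andbT.
by case: ifP => // _ /eqP; rewrite -addn2 -[X in X == _]addn0 eqn_add2l.
Qed.

Definition no_relators w : Prop := False.

Definition free_group : groupType := presented no_relators.
Local Notation cls := (pres_class no_relators).

Definition reduced_word (x : free_group) : word A := nf (repr x).
Local Notation rw := reduced_word.

(** Free reduction is an action of the free group on reduced words. *)
Lemma pres_eq_nf u w : pres_eq no_relators u w -> nf u = nf w.
Proof.
move=> uw; pose T := {w | reduced w}.
pose act l (s : T) : T := exist (fun v => reduced v) _ (push_reduced l (valP s)).
have actE v (s : T) : val (wact act v s) = foldr push (val s) v.
  by elim: v => //= l v ->.
have actK c d s : act (c, d) (act (c, ~~ d) s) = s.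
  by apply: val_inj; case: s => s /= reds; rewrite (pushK (c, d)).
pose s0 : T := exist (fun v => reduced v) [::] isT.
rewrite /nf -[LHS](actE u s0) -[RHS](actE w s0).
by congr val; apply: pres_eq_wact uw _.
Qed.

Lemma rw_class w : rw (cls w) = nf w.
Proof. exact/pres_eq_nf/pres_eq_repr. Qed.

Lemma rw_reduced x : reduced (rw x).
Proof. exact: nf_reduced. Qed.

Lemma rwK x : (cls (rw x)) = x.
Proof.
rewrite -[RHS]pres_class_repr; apply/pres_classP; rewrite /rw.
elim: (repr x) => [|l w IHw] /=; first exact: pres_eq_refl.
apply: (@pres_eq_trans _ _ _ (l :: nf w)).
  case: (nf w) => [|b v] /=; first exact: pres_eq_refl.
  case: eqP => [->|_]; last exact: pres_eq_refl.
  apply: pres_eq_sym; rewrite -[_ :: v]cat1s -cat1s catA -[X in pres_eq _ _ X]cat0s.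
  apply: pres_eq_cat; last exact: pres_eq_refl.
  by case: l => a c; apply: pres_eq_cancel.
rewrite -cat1s -(cat1s l w).
by apply: pres_eq_cat => //; apply: pres_eq_refl.
Qed.

Lemma rw_eq x w : reduced w -> x = (cls w) -> rw x = w.
Proof. by move=> redw ->; rewrite rw_class nf_id. Qed.

Lemma rw_inj : injective rw.
Proof. exact: can_inj rwK. Qed.

Lemma rw1 : rw 1 = [::].
Proof. exact: (@rw_eq _ [::]). Qed.

Lemma rwV x : rw x^-1 = inv_word (rw x).
Proof.
apply: rw_eq; first by rewrite reduced_inv rw_reduced.
by rewrite -pres_classV rwK.
Qed.

Definition len x : nat := size (rw x).

Lemma lenV x : len x^-1 = len x.
Proof. by rewrite /len rwV size_inv_word. Qed.

(** In a product [x * y] only the common prefix of [x^-1] and [y] cancels, so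
    a bound on that prefix guarantees that the beginning of [x] survives. *)
Lemma rw_mul_prefix C x y : take C (rw x^-1) <> take C (rw y) ->
  exists r, rw (x * y) = take (len x - C) (rw x) ++ r.
Proof.
move=> diff; have [q [s [t [sE tE st]]]] := common_prefix (rw x^-1) (rw y).
have qC : size q <= C.
  rewrite leqNgt; apply/negP => Cq; apply: diff.
  by rewrite sE tE !takel_cat // ltnW.
have xE : rw x = inv_word s ++ inv_word q.
  by rewrite -inv_word_cat -sE rwV inv_wordK.
have lenx : len x - C <= size (inv_word s).
  by rewrite /len xE size_cat !size_inv_word leq_subLR addnC leq_add2r.
exists (drop (len x - C) (inv_word s) ++ t).
rewrite [in RHS]xE takel_cat // catA cat_take_drop; apply: rw_eq.
  have reds : reduced (inv_word s).
    by apply: (@reduced_catl _ (inv_word q)); rewrite -xE rw_reduced.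
  have redt : reduced t.
    by apply: (@reduced_catr q); rewrite -tE rw_reduced.
  case: s t {sE xE lenx tE} st reds redt => [|a s] [|b t] //.
    by rewrite cats0.
  rewrite inv_word_cons cat_rcons reduced_cat_cons => ab -> redt /=.
  by rewrite linvK eq_sym ab.
rewrite -{1}(rwK x) -(rwK y) xE tE -!pres_classM -!pres_classV.
by rewrite !mulgA mulgVK.
Qed.

(** * Periodicity of powers *)

Definition wpow w m : word A := flatten (nseq m w).

Lemma size_wpow w m : size (wpow w m) = (m * size w)%N.
Proof. by elim: m => //= m IHm; rewrite size_cat IHm mulSn. Qed.

Lemma wpowS w m : wpow w m.+1 = w ++ wpow w m.
Proof. by []. Qed.

Lemma wpowSr w m : wpow w m.+1 = wpow w m ++ w.
Proof.
elim: m => [|m IHm]; first exact: cats0.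
by rewrite wpowS {1}IHm catA.
Qed.

Lemma class_wpow w m : (cls (wpow w m)) = ((cls w : free_group) ^+ m)%g.
Proof. by elim: m => // m IHm; rewrite expgS -IHm pres_classM. Qed.

Lemma reduced_wpow w m : w != [::] -> reduced (w ++ w) -> reduced (wpow w m).
Proof.
move=> w0 redw; case: m => // m; elim: m => [|m IHm].
  by rewrite /wpow /= cats0 (reduced_catl redw).
exact: reduced_overlap.
Qed.

(** Cancelling letters that are inverse to each other at the two ends of a word
    leads to a cyclically reduced one. *)
Lemma cyclic_reduction w : w != [::] -> reduced w ->
  exists p c, [/\ w = p ++ c ++ inv_word p, c != [::] & reduced (c ++ c)].
Proof.
have [n] := ubnP (size w); elim: n w => // n IHn [|a w] //=.
case/lastP: w => [|w b] wn _ redw.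
  by exists [::], [:: a]; split=> //=; rewrite linv_neq.
have [bE|ba] := eqVneq b (linv a); last first.
  exists [::], (a :: rcons w b); split=> //=; first by rewrite cats0.
  rewrite cat_path redw /= last_rcons redw andbT.
  by rewrite -(inj_eq (can_inj linvK)) linvK eq_sym.
have redw' : reduced w.
  by apply: (@reduced_catl _ [:: b]); rewrite cats1; apply: (@reduced_catr [:: a]).
have w0 : w != [::].
  by apply/eqP => w0; move: redw; rewrite w0 bE /= eqxx.
have [|p [c [wE c0 redc]]] := IHn w _ w0 redw'.
  by move: wn; rewrite size_rcons; lia.
exists (a :: p), c; split=> //.
by rewrite wE bE inv_word_cons -!cats1 /= -!catA.
Qed.

(** In the Cayley tree, [p] is the path from the origin to the axis of [x], and [c]
    labels a period of this axis. *)
Definition cyclic_form (x : free_group) (p c : word A) : Prop :=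
  [/\ c != [::], reduced (c ++ c),
      x = (cls p) * (cls c) * (cls p)^-1 &
      forall m, 0 < m -> rw (x ^+ m) = p ++ wpow c m ++ inv_word p].

Lemma cyclic_formP x : x != 1 -> exists p c, cyclic_form x p c.
Proof.
move=> x1; have rx0 : rw x != [::] by rewrite -rw1 (inj_eq rw_inj).
have [p [c [xE c0 redc]]] := cyclic_reduction rx0 (rw_reduced x).
have redx : reduced (p ++ c ++ inv_word p) by rewrite -xE rw_reduced.
have xE' : x = (cls p) * (cls c) * (cls p)^-1.
  by rewrite -(rwK x) xE pres_classV !pres_classM catA.
exists p, c; split=> // -[//|m] _; apply: rw_eq.
  rewrite wpowSr -catA catA; apply: reduced_overlap => //; last first.
    exact: reduced_catr redx.
  rewrite -catA -wpowSr /=; apply: reduced_overlap => //.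
    by apply: (@reduced_catl _ (inv_word p)); rewrite -catA.
  exact: (@reduced_wpow c m.+1).
rewrite -!pres_classM class_wpow -pres_classV -mulgA mulgA.
have -> : x = (cls c) ^ (cls p)^-1 by rewrite conjgE invgK xE' mulgA.
by rewrite -expgS -conjXg conjgE invgK.
Qed.

Lemma cyclic_form_size x p c : cyclic_form x p c -> len x = size p + size c + size p.
Proof.
case=> _ _ _ /(_ 1%N isT); rewrite expg1 /wpow /= cats0 /len => ->.
by rewrite !size_cat size_inv_word addnA.
Qed.

Lemma len_exp x m : x != 1 -> m <= len (x ^+ m).
Proof.
case: m => // m /cyclic_formP[p [c [c0 _ _ /(_ m.+1 isT)]]]; rewrite /len => ->.
by rewrite !size_cat size_wpow; case: c c0 => //= a c _; lia.
Qed.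

(** Beyond [p], the prefixes of a power of [x] are translated by [x] along the
    axis of [x] in the Cayley tree. *)
Lemma mul_prefix x p c m j : cyclic_form x p c ->
  size p <= j -> j + size c <= size p + (m * size c)%N ->
  x * (cls (take j (rw (x ^+ m)))) = (cls (take (j + size c) (rw (x ^+ m)))).
Proof.
case=> c0 _ xE xmE /subnKC <-; set i := j - size p.
rewrite -addnA leq_add2l.
case: m => [|m]; first by case: c c0 {xE xmE} => //= a c _; lia.
rewrite mulSn [X in _ <= X]addnC leq_add2r => im; rewrite xmE //.
rewrite !take_size_add wpowS -catA addnC take_size_add.
rewrite (catA c) -wpowS wpowSr -!catA.
rewrite !takel_cat ?size_wpow // xE -!pres_classM.
by rewrite !mulgA mulgVK.
Qed.

(** Two axes with a common segment longer than both translation lengths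
    together are moved along it by [z] and [w] in either order in the same
    way. Since a free group acts freely on its Cayley tree, the two elements
    commute. *)
Lemma commute_common_prefix (z w : free_group) m n :
  len z + len w <= m -> len z + len w <= n ->
  take (len z + len w) (rw (z ^+ m)) = take (len z + len w) (rw (w ^+ n)) ->
  commute z w.
Proof.
have [->|z1] := eqVneq z 1; first by move=> *; apply/commute_sym/commute1.
have [->|w1] := eqVneq w 1; first by move=> *; apply/commute1.
have [p [c zc]] := cyclic_formP z1; have [q [d wd]] := cyclic_formP w1.
have [[c0 _ _ _] [d0 _ _ _]] := (zc, wd).
rewrite -!size_eq0 in c0 d0.
have [zE wE] := (cyclic_form_size zc, cyclic_form_size wd).
set C := _ + _ => Cm Cn eqC; pose j := maxn (size p) (size q).
have jC : j + size c + size d <= C by rewrite /j /C zE wE; lia.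
have eqj i : i <= C -> take i (rw (w ^+ n)) = take i (rw (z ^+ m)).
  by move=> iC; apply/esym/(take_leq_eq iC).
have Cmc : C <= (m * size c)%N by apply: leq_trans Cm _; rewrite leq_pmulr ?lt0n.
have Cnd : C <= (n * size d)%N by apply: leq_trans Cn _; rewrite leq_pmulr ?lt0n.
have zq i : j <= i -> i + size c <= C ->
    z * (cls (take i (rw (z ^+ m)))) = (cls (take (i + size c) (rw (z ^+ m)))).
  by move=> ji iC; apply: (mul_prefix zc); rewrite /j in ji; lia.
have wq i : j <= i -> i + size d <= C ->
    w * (cls (take i (rw (z ^+ m)))) = (cls (take (i + size d) (rw (z ^+ m)))).
  move=> ji iC; rewrite -!eqj; try lia.
  by apply: (mul_prefix wd); rewrite /j in ji; lia.
apply: (@mulIg _ (cls (take j (rw (z ^+ m))))).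
rewrite -!mulgA zq ?wq ?zq; try lia.
by rewrite addnAC.
Qed.

Lemma noncommute_neq1 (x y : free_group) : x * y != y * x -> x != 1.
Proof. by apply: contraNneq => ->; rewrite mul1g mulg1. Qed.

(** Each factor of a product of high powers loses at most a bounded part of
    its reduced word to its neighbours, so the beginning of the first factor
    survives in the whole product. *)
Lemma big_powers z (zs : seq free_group) :
  z != 1 -> path (fun x y => x * y != y * x) z zs ->
  exists m, \prod_(x <- z :: zs) x ^+ m != 1.
Proof.
move=> z1 zzs; pose M := \max_(x <- z :: zs) len x.
have {zzs} : path (fun x y => x * y != y * x) z zs /\
    all (fun x => len x <= M) (z :: zs).
  by split=> //; apply/allP => x xz; apply: leq_bigmax_seq.
(* By [commute_common_prefix], at most [C] letters cancel between neighbours; [m]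
   makes each factor longer than the [C] letters that it can lose at either end. *)
move: M => M [zzs zsM]; pose C := M + M; pose m := C.+1 + C; exists m.
suff [_ szP] : take C.+1 (rw (\prod_(x <- z :: zs) x ^+ m))
      = take C.+1 (rw (z ^+ m)) /\ C < len (\prod_(x <- z :: zs) x ^+ m).
  by apply: contraTneq szP => ->; rewrite /len rw1.
have lenm x : x != 1 -> C.+1 <= len (x ^+ m) - C.
  by move=> x1; have := len_exp m x1; rewrite /m; lia.
elim: zs z z1 zzs zsM => [|w zs IHzs] z z1 /=.
  by move=> _ _; rewrite big_seq1; split=> //; have := lenm _ z1; lia.
case/andP=> zw wzs /and3P[zM wM zsM].
have w1 : w != 1 by apply: (@noncommute_neq1 _ z); rewrite eq_sym.
have [|eqw szw] := IHzs w w1 wzs; first by rewrite /= wM.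
rewrite big_cons; set P := \prod_(x <- w :: zs) x ^+ m in eqw szw *.
have [|r rE] := @rw_mul_prefix C (z ^+ m) P.
  move/eqP: zw => + eqC; apply.
  suff : commute z^-1 w by move/commute_sym/commuteV; rewrite invgK => /commute_sym.
  apply: (@commute_common_prefix _ _ m m); rewrite lenV;
    try by rewrite /m /C; lia.
  apply: (@take_leq_eq _ _ _ _ C); first by rewrite /C; lia.
  rewrite expVgn eqC; exact: take_leq_eq eqw.
have zC := lenm z z1.
have szt : size (take (len (z ^+ m) - C) (rw (z ^+ m))) = len (z ^+ m) - C.
  by rewrite size_takel ?leq_subr.
rewrite /len rE size_cat szt takel_cat ?szt // take_takel //.
by split=> //; lia.
Qed.

(** * Commuting elements of a free group *)

(** If [x] is cyclically reduced then one of [x], [x^-1] has no cancellation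
    with a commuting [y], on either side, so that the two words commute in the
    free monoid, where they have a common power. *)
Lemma commute_common_power (x y : free_group) : x != 1 -> y != 1 -> commute x y ->
  exists m n, [/\ 0 < m, 0 < n & x ^+ m = y ^+ n \/ x ^+ m = y^-1 ^+ n].
Proof.
move=> x1 y1 xy; have [p [c [c0 redc xE _]]] := cyclic_formP x1.
pose g : free_group := cls p; pose t := rw (y ^ g).
have xgE : x ^ g = cls c by rewrite xE conjgE !mulgA mulVg mul1g mulgVK.
have t1 : t != [::] by rewrite -rw1 (inj_eq rw_inj) conjg_eq1.
have words_eq (s : word A) : s != [::] -> reduced (s ++ t) ->
    commute (cls s : free_group) (y ^ g) ->
    (cls s : free_group) ^+ size t = (y ^ g) ^+ size s.
  move=> s0 redst sy; rewrite -(rwK (y ^ g)) -/t -!class_wpow; congr (cls _).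
  have stE : s ++ t = t ++ s.
    have nfst : nf (t ++ s) = s ++ t.
      rewrite -(nf_id redst) -!rw_class -!pres_classM rwK.
      by congr (rw _); rewrite sy.
    rewrite -[LHS]nfst; apply/nf_id/size_nf_reduced.
    by rewrite nfst !size_cat addnC.
  (* Powers of equal length of commuting words are equal. *)
  have comm1 m : wpow s m ++ t = t ++ wpow s m.
    elim: m => [|m IHm]; first by rewrite cats0.
    by rewrite wpowS -catA IHm !catA stE.
  have comm2 m n : wpow s m ++ wpow t n = wpow t n ++ wpow s m.
    elim: n => [|n IHn]; first by rewrite cats0.
    by rewrite wpowS catA comm1 -!catA IHn.
  move/eqP: (comm2 (size t) (size s)).
  by rewrite eqseq_cat ?size_wpow 1?mulnC // => /andP[/eqP].
have xyg : commute (cls c : free_group) (y ^ g) by rewrite -xgE /commute -!conjMg xy.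
have sz0 (s : word A) : s != [::] -> 0 < size s by case: s.
exists (size t), (size c); split; rewrite ?sz0 //.
have [redct|nredct] := boolP (reduced (c ++ t)); [left | right].
  by apply: (@conjg_inj _ g); rewrite !conjXg xgE words_eq.
apply: (@invg_inj free_group); apply: (@conjg_inj _ g).
rewrite -!expVgn invgK !conjXg conjVg xgE pres_classV.
rewrite -[size c]size_inv_word; apply: words_eq.
- by rewrite -size_eq0 size_inv_word size_eq0.
- (* If [c ++ t] is not reduced then [t] starts with the inverse of the last
     letter of [c], which is not the first letter of [c]. *)
  have redt : reduced t := rw_reduced _.
  case: t t1 redt nredct => // a t _ redt.
  rewrite -[c in c ++ a :: t]revK; case: (rev c) (revK c) => [|b s] cE.
    by rewrite -cE in c0.
  rewrite rev_cons reduced_rcons_cat redt -rev_cons cE (reduced_catl redc) /=.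
  rewrite andbT negbK => /eqP aE.
  case: c {xE xgE xyg} c0 redc cE => // d c _ redc cE.
  rewrite inv_word_cons reduced_rcons_cat redt -inv_word_cons reduced_inv.
  rewrite (reduced_catl redc) /= andbT linvK aE.
  by move: redc; rewrite -{1}cE rev_cons reduced_rcons_cat eq_sym => /and3P[].
- by rewrite -pres_classV; apply/commute_sym/commuteV/commute_sym.
Qed.

(** Large powers of [x] and [y] that coincide have a long common prefix. *)
Lemma commute_roots (x y : free_group) m n : 0 < m -> 0 < n ->
  x ^+ m = y ^+ n -> commute x y.
Proof.
move=> m0 n0 xy; pose C := len x + len y.
apply: (@commute_common_prefix _ _ (m * C) (n * C)); rewrite ?leq_pmull //.
by rewrite !expgnA xy.
Qed.

(** After inverting [y] and [z] if necessary, both have a positive power in common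
    with [x], hence with each other. *)
Lemma commute_trans (x y z : free_group) :
  x != 1 -> commute x y -> commute x z -> commute y z.
Proof.
have [->|y1] := eqVneq y 1; first by move=> *; apply/commute_sym/commute1.
have [->|z1] := eqVneq z 1; first by move=> *; apply/commute1.
move=> x1 xy xz.
have pos (t : free_group) : t != 1 -> commute x t -> exists s m n,
    [/\ 0 < m, 0 < n, x ^+ m = s ^+ n
      & forall a : free_group, commute s a -> commute t a].
  move=> t1 /(commute_common_power x1 t1)[m [n [m0 n0 xt]]].
  case: xt => xt; [exists t | exists t^-1]; exists m, n; split=> // a ta.
  by apply/commute_sym; rewrite -[t]invgK; apply/commuteV/commute_sym.
have [s [m [n [m0 n0 xs sy]]]] := pos y y1 xy.
have [t [m' [n' [m0' n0' xt tz]]]] := pos z z1 xz.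
apply/sy/commute_sym/tz/commute_sym.
apply: (@commute_roots _ _ (n * m') (n' * m)); rewrite ?muln_gt0 ?n0 ?n0' //.
by rewrite !expgnA -xs -xt expgnAC.
Qed.

End ReducedWords.

Arguments free_group : clear implicits.

(** * A semidirect product decomposition of [BP3 k] *)

(** This holds for the subgroups of a semidirect product of a free group by the
    integers: [phi] is the projection to the integers, and [kappa] the coordinate
    in the free group, a homomorphism only on the kernel of [phi]. Stating it with
    coordinates makes it pass to subgroups at once. *)
Definition free_by_cyclic (H : groupType) : Prop :=
  exists (A : choiceType) (phi : H -> int) (kappa : H -> free_group A),
    [/\ forall x y, phi (x * y) = (phi x + phi y)%R,
        forall x y, phi x = 0%R -> kappa (x * y) = kappa x * kappa y
      & forall x, phi x = 0%R -> kappa x = 1 -> x = 1].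

Lemma free_by_cyclic_sub (H G : groupType) :
  embeds_in H G -> free_by_cyclic G -> free_by_cyclic H.
Proof.
case=> f fI [A [phi [kappa [phiM kM kI]]]].
exists A, (phi \o f), (kappa \o f); split=> [x y|x y|x] /=.
- by rewrite gmulfM phiM.
- by rewrite gmulfM; apply: kM.
- have f1 : f 1 = 1 by apply: morph_one => y z; apply: gmulfM.
  by move=> px kx; apply: fI; rewrite f1; apply: kI.
Qed.

Section BP3FreeByCyclic.
Variable k' : nat.
Let k := k'.+1.
Let G := BP3 k.

Local Notation gG := (@gen _ (BP3_relators k)).
Local Notation a := (gG w0 : G).
Local Notation b := (gG w1 : G).
Local Notation c := (gG w2 : G).

Lemma BP3_commute_ab : commute a (b ^+ k).
Proof.
have /gen_relator/eval_comm : BP3_relators k (comm_word (letter w0) (letter_exp w1 k)).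
  by left.
by rewrite eval_exp eval_letter.
Qed.

Lemma BP3_commute_ac : commute a c.
Proof.
have /gen_relator/eval_comm : BP3_relators k (comm_word (letter w0) (letter w2)).
  by right.
by rewrite !eval_letter.
Qed.

Let F := free_group (option 'I_k : choiceType).
Local Notation gF := (@gen _ (@no_relators (option 'I_k : choiceType))).
Let al (i : 'I_k) : F := gF (Some i).
Let cF : F := gF None.

(** Conjugation by [b] on the free kernel, with [al i] the conjugate of [a b^-1] by
    [b^i]. It permutes the [al i] cyclically because [b^k] commutes with [a]; it
    sends [c] to its conjugate by [(al 0)^-1] because [a = (al 0) b] commutes with
    [c]. *)
Definition sigma_gen (o : option 'I_k) : F :=
  if o is Some i then al (ordS i) else (al ord0)^-1 * cF * al ord0.
Definition tau_gen (o : option 'I_k) : F :=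
  if o is Some i then al (ord_pred i)
  else al (ord_pred ord0) * cF * (al (ord_pred ord0))^-1.

Let no_rel (A : choiceType) (H : groupType) (v : A -> H) r :
  no_relators r -> eval v r = 1.
Proof. by []. Qed.

Definition sigma (u : F) : F := pres_lift sigma_gen u.
Definition tau (u : F) : F := pres_lift tau_gen u.

Lemma sigmaM : {morph sigma : x y / x * y}.
Proof. exact/pres_liftM/no_rel. Qed.

Lemma tauM : {morph tau : x y / x * y}.
Proof. exact/pres_liftM/no_rel. Qed.

Lemma sigma_al i : sigma (al i) = al (ordS i).
Proof. exact/pres_lift_gen/no_rel. Qed.

Lemma sigma_c : sigma cF = (al ord0)^-1 * cF * al ord0.
Proof. exact/pres_lift_gen/no_rel. Qed.

Lemma tau_al i : tau (al i) = al (ord_pred i).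
Proof. exact/pres_lift_gen/no_rel. Qed.

Lemma tau_c : tau cF = al (ord_pred ord0) * cF * (al (ord_pred ord0))^-1.
Proof. exact/pres_lift_gen/no_rel. Qed.

Lemma sigmaK : cancel sigma tau.
Proof.
apply: (@morph_eq_gen _ _ F (tau \o sigma) id) => //.
  by move=> x y /=; rewrite sigmaM tauM.
case=> [i|] /=; first by rewrite sigma_al tau_al ordSK.
rewrite sigma_c !tauM (morph_inv tauM) tau_c tau_al.
by rewrite !mulgA mulVg mul1g mulgVK.
Qed.

Lemma tauK : cancel tau sigma.
Proof.
apply: (@morph_eq_gen _ _ F (sigma \o tau) id) => //.
  by move=> x y /=; rewrite tauM sigmaM.
case=> [i|] /=; first by rewrite tau_al sigma_al ord_predK.
rewrite tau_c !sigmaM (morph_inv sigmaM) sigma_c sigma_al ord_predK.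
by rewrite !mulgA mulgV mul1g mulgK.
Qed.

Lemma iter_ordS n (i : 'I_k) : iter n (@ordS k) i = ((i + n) %% k)%N :> nat.
Proof.
elim: n => [|n IHn] /=; first by rewrite addn0 modn_small.
by rewrite IHn -addn1 modnDml addn1 addnS.
Qed.

Lemma iter_sigma_al n i : iter n sigma (al i) = al (iter n (@ordS k) i).
Proof. by elim: n => //= n ->; rewrite sigma_al. Qed.

Lemma iter_sigmaM n : {morph iter n sigma : x y / x * y}.
Proof. by elim: n => // n IHn x y; rewrite !iterS IHn sigmaM. Qed.

(** The action of [G] on the cosets of the subgroup generated by [b], which are
    represented by the elements of the free kernel: [b] acts by conjugation, the
    kernel by left multiplication, and [a = (al 0) b] by their composition. *)
Definition kernel_act (l : 'I_3 * bool) (u : F) : F :=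
  if l.1 == w0 then if l.2 then tau ((al ord0)^-1 * u) else al ord0 * sigma u
  else if l.1 == w1 then if l.2 then tau u else sigma u
  else if l.2 then cF^-1 * u else cF * u.

Lemma kernel_actK x s u : kernel_act (x, s) (kernel_act (x, ~~ s) u) = u.
Proof.
rewrite /kernel_act /=; case: (x == w0); last case: (x == w1).
- by case: s => /=; rewrite ?mulKg ?sigmaK ?tauK ?mulVKg.
- by case: s => /=; rewrite ?sigmaK ?tauK.
- by case: s => /=; rewrite ?mulKg ?mulVKg.
Qed.

Lemma kernel_act_relator r : BP3_relators k r ->
  forall u, wact kernel_act r u = u.
Proof.
case=> ->; apply: wact_comm => [|u]; try exact: kernel_actK.
  have actb n v : wact kernel_act (letter_exp w1 n) v = iter n sigma v.
    by elim: n => //= n ->.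
  have acta v : wact kernel_act (letter w0) v = al ord0 * sigma v by [].
  have ordk : iter k (@ordS k) ord0 = ord0.
    by apply: val_inj; rewrite [LHS]iter_ordS add0n modnn.
  by rewrite !actb !acta iter_sigmaM iter_sigma_al ordk -iterSr -iterS.
by rewrite /= /kernel_act /= sigmaM sigma_c !mulgA mulgV mul1g.
Qed.

Definition height_weight (x : 'I_3) : int := if x == w2 then 0%R else 1%R.

Lemma height_relator r : BP3_relators k r -> exponent_sum height_weight r = 0%R.
Proof. by case=> ->; apply: exponent_sum_comm. Qed.

Let height (x : G) : int := pdeg height_weight x.
Let kap (x : G) : F := pact kernel_act x 1.

(** The free coordinate of a product: the height of the left factor twists the
    coordinate of the right factor. *)
Lemma wact_twist w u :
  wact kernel_act w u =
  wact kernel_act w 1 * ziter sigma tau (exponent_sum height_weight w) u.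
Proof.
elim: w => [|[x s] w IHw]; first by rewrite /exponent_sum big_nil mul1g.
rewrite -cat1s exponent_sum_cat !wact_cat IHw; set U := wact _ w 1.
rewrite [exponent_sum _ [:: _]]big_seq1 /= /kernel_act /height_weight /=.
have -> : (x == w2) = (x != w0) && (x != w1) by case: x => -[|[|[|]]].
have plus n v : ziter sigma tau (1 + n)%R v = sigma (ziter sigma tau n v).
  by rewrite addrC (ziterS tauK).
have minus n v : ziter sigma tau (-1 + n)%R v = tau (ziter sigma tau n v).
  by rewrite addrC (ziterP sigmaK tauK).
case: (x == w0) => /=; last case: (x == w1) => /=.
- by case: s; rewrite ?plus ?minus ?tauM ?sigmaM ?mulgA.
- by case: s; rewrite ?plus ?minus ?tauM ?sigmaM ?mulgA.
- by case: s; rewrite ?oppr0 ?add0r mulgA.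
Qed.

Definition unkernel_gen (o : option 'I_k) : G :=
  if o is Some i then b ^+ i * (a / b) / b ^+ i else c.
Definition unkernel (u : F) : G := pres_lift unkernel_gen u.

Lemma unkernelM : {morph unkernel : x y / x * y}.
Proof. exact/pres_liftM/no_rel. Qed.

Lemma unkernel_gF o : unkernel (gF o) = unkernel_gen o.
Proof. exact/pres_lift_gen/no_rel. Qed.

Lemma unkernel_al0 : unkernel (al ord0) = a / b.
Proof. by rewrite unkernel_gF /= expg0 invg1 mulg1 mul1g. Qed.

Lemma unkernel_sigma u : unkernel (sigma u) = b * unkernel u / b.
Proof.
move: u; pose conjb u := b * unkernel u / b.
apply: (@morph_eq_gen _ _ G (unkernel \o sigma) conjb); rewrite /conjb.
- by move=> x y /=; rewrite sigmaM unkernelM.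
- by move=> x y /=; rewrite unkernelM !mulgA mulgVK.
case=> [i|] /=.
  rewrite sigma_al !unkernel_gF /=.
  have -> : b * (b ^+ i * (a / b) / b ^+ i) / b
            = b ^+ i.+1 * (a / b) / b ^+ i.+1.
    by rewrite expgS invgM !mulgA.
  have [ik|] := ltnP i.+1 k; first by rewrite modn_small.
  rewrite leq_eqVlt ltnNge ltn_ord orbF => /eqP <-; rewrite modnn.
  have bk : b ^+ k * (a / b) = a / b * b ^+ k.
    rewrite mulgA -BP3_commute_ab -!mulgA; congr (_ * _).
    exact: commuteV (commute_sym (commuteX k (commute_refl b))).
  by rewrite bk mulgK invg1 mulg1 mul1g.
rewrite sigma_c !unkernelM (morph_inv unkernelM) unkernel_al0 unkernel_gF /=.
rewrite invgF -!mulgA; congr (_ * _); rewrite (mulgA c) -BP3_commute_ac.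
by rewrite -mulgA mulKg.
Qed.

Lemma unkernel_tau u : unkernel (tau u) = b^-1 * unkernel u * b.
Proof. by rewrite -{2}(tauK u) unkernel_sigma -!mulgA mulVg mulg1 mulKg. Qed.

(** Every element is recovered from its free coordinate and its height, so that
    [kap] is injective on the kernel. *)
Lemma class_unkernel w :
  pres_class (BP3_relators k) w =
  unkernel (wact kernel_act w 1) * zpow b (exponent_sum height_weight w).
Proof.
elim: w => [|[x s] w IHw].
  rewrite /exponent_sum big_nil mulg1.
  by rewrite (morph_one unkernelM).
rewrite -cat1s -pres_classM IHw exponent_sum_cat !wact_cat.
set U := wact _ w 1; set n := exponent_sum _ w.
rewrite [exponent_sum _ [:: _]]big_seq1 /= /kernel_act /height_weight /=.
have -> : (x == w2) = (x != w0) && (x != w1) by case: x => -[|[|[|]]].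
have plus : zpow b (1 + n)%R = b * zpow b n by rewrite addrC zpowS.
have minus : zpow b (-1 + n)%R = b^-1 * zpow b n by rewrite addrC zpowP.
have genE : pres_class (BP3_relators k) [:: (x, s)] = if s then (gG x)^-1 else gG x.
  by case: (s); rewrite /gen ?pres_classV.
rewrite genE {genE}; case: eqVneq => [->|x0] /=; last case: eqVneq => [->|x1] /=.
- case: s; rewrite ?plus ?minus ?unkernel_tau ?unkernelM ?(morph_inv unkernelM)
    ?unkernel_sigma unkernel_al0.
    by rewrite invgF !mulgA mulVg mul1g mulgK.
  by rewrite !mulgA !mulgVK.
- case: s; rewrite ?plus ?minus ?unkernel_tau ?unkernel_sigma.
    by rewrite !mulgA mulgK.
  by rewrite !mulgA mulgVK.
- have -> : x = w2 by apply/val_inj; case: x x0 x1 => -[|[|[|]]].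
  by case: s; rewrite ?oppr0 add0r unkernelM ?(morph_inv unkernelM) unkernel_gF /= mulgA.
Qed.

Lemma BP3_free_by_cyclic : free_by_cyclic G.
Proof.
exists (option 'I_k : choiceType), height, kap; split=> [x y|x y|x].
- exact/pdegM/height_relator.
- rewrite /kap pactM; [|exact: kernel_actK|exact: kernel_act_relator].
  by rewrite /height /pdeg /pact => x0; rewrite wact_twist x0.
- rewrite /height /pdeg /kap /pact => x0 k0.
  rewrite -(pres_class_repr x) class_unkernel x0 k0 mulg1.
  by rewrite (morph_one unkernelM).
Qed.

End BP3FreeByCyclic.

(** * The kernel of the height function *)

Section HeightKernel.
Variables (H : groupType) (phi : H -> int).
Hypothesis phiM : forall x y, phi (x * y) = (phi x + phi y)%R.

Lemma additive_one : phi 1 = 0%R.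
Proof. by have := phiM 1 1; rewrite mulg1; lia. Qed.

Lemma additive_inv x : phi x^-1 = (- phi x)%R.
Proof. by have := phiM x^-1 x; rewrite mulVg additive_one; lia. Qed.

Lemma additive_zpow x n : phi (zpow x n) = (n * phi x)%R.
Proof.
have phiX m : phi (x ^+ m) = (Posz m * phi x)%R.
  elim: m => [|m IHm]; first by rewrite expg0 additive_one mul0r.
  by rewrite expgS phiM IHm; lia.
by case: n => n; rewrite /= ?additive_inv phiX // NegzE; lia.
Qed.

Variables (A : choiceType) (kappa : H -> free_group A).
Hypothesis kappaM : forall x y, phi x = 0%R -> kappa (x * y) = kappa x * kappa y.
Hypothesis kappa_eq1 : forall x, phi x = 0%R -> kappa x = 1 -> x = 1.

Lemma phiX x n : phi x = 0%R -> phi (x ^+ n) = 0%R.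
Proof. by move=> x0; rewrite -/(zpow x n) additive_zpow x0 mulr0. Qed.

Lemma kappa1 : kappa 1 = 1.
Proof. by apply: (@mulgI _ (kappa 1)); rewrite -kappaM ?additive_one // !mulg1. Qed.

Lemma kappaX x n : phi x = 0%R -> kappa (x ^+ n) = kappa x ^+ n.
Proof.
move=> x0; elim: n => [|n IHn]; first exact: kappa1.
by rewrite !expgS kappaM // IHn.
Qed.

Lemma kappaV x : phi x = 0%R -> kappa x^-1 = (kappa x)^-1.
Proof. by move=> x0; apply/esym/mulg1_eq; rewrite -kappaM // mulgV kappa1. Qed.

Lemma kappa_inj x y : phi x = 0%R -> phi y = 0%R -> kappa x = kappa y -> x = y.
Proof.
move=> x0 y0 xy; apply/divg1_eq/kappa_eq1; first by rewrite phiM additive_inv x0 y0.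
by rewrite kappaM // kappaV // xy mulgV.
Qed.

Lemma kappa_neq1 x : phi x = 0%R -> x != 1 -> kappa x != 1.
Proof. by move=> x0; apply: contra_neq; apply: kappa_eq1. Qed.

Lemma kappa_commute x y : phi x = 0%R -> phi y = 0%R ->
  commute x y <-> commute (kappa x) (kappa y).
Proof.
move=> x0 y0; rewrite /commute -!kappaM //; split=> [->//|].
by apply: kappa_inj; rewrite phiM x0 y0.
Qed.

Lemma kernel_commute_trans x y z :
    phi x = 0%R -> phi y = 0%R -> phi z = 0%R ->
  x != 1 -> commute x y -> commute x z -> commute y z.
Proof.
move=> x0 y0 z0 x1 /kappa_commute-/(_ x0 y0) xy /kappa_commute-/(_ x0 z0) xz.
by apply/kappa_commute => //; apply: commute_trans xy xz; apply: kappa_neq1.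
Qed.

Lemma kernel_common_power x y : phi x = 0%R -> phi y = 0%R ->
  x != 1 -> y != 1 -> commute x y ->
  exists m n, 0 < m /\ x ^+ m = zpow y n.
Proof.
move=> x0 y0 x1 y1 /kappa_commute-/(_ x0 y0).
case/commute_common_power; rewrite ?kappa_neq1 // => m [n [m0 n0 xyE]].
case: xyE => xyE; [exists m, (Posz n) | exists m, (- Posz n)%R]; split=> //.
  by apply: kappa_inj; rewrite ?phiX // !kappaX.
rewrite zpowV /= -expVgn; apply: kappa_inj; rewrite ?phiX ?additive_inv ?y0 //.
by rewrite !kappaX ?additive_inv ?y0 // kappaV.
Qed.

Lemma kernel_big_powers z zs : all (fun x => phi x == 0%R) (z :: zs) ->
  z != 1 -> path (fun x y => ~~ (x * y == y * x)) z zs ->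
  exists m, \prod_(x <- z :: zs) x ^+ m <> 1.
Proof.
move=> zs0 z1 zzs.
have [m zm] : exists m, \prod_(x <- kappa z :: map kappa zs) x ^+ m != 1.
  case/andP: (zs0) => /eqP z0 _.
  apply: big_powers; first exact: kappa_neq1.
  rewrite path_map; apply: sub_in_path zs0 zzs => x y /eqP x0 /eqP y0 /=.
  by apply: contra => /eqP; rewrite -!kappaM // => /kappa_inj->//; rewrite phiM x0 y0.
exists m => zs1; case/eqP: zm; rewrite -[RHS]kappa1 -zs1 -map_cons big_map.
elim: (z :: zs) zs0 => [|x s IHs] /=; first by rewrite !big_nil kappa1.
by case/andP=> /eqP x0 s0; rewrite !big_cons kappaM ?phiX // kappaX // IHs.
Qed.

End HeightKernel.

(** * Right-angled Artin groups of cycles *)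

Section Raag.
Variables (V : finType) (e : rel V).
Local Notation g := (@gen _ (raag_relators e)).

Lemma raag_commute x y : e x y -> commute (g x : raag e) (g y).
Proof.
move=> exy.
have /gen_relator/eval_comm : raag_relators e (comm_word (letter x) (letter y)).
  by exists x, y.
by rewrite !eval_letter.
Qed.

Definition gdeg (v : V) (x : raag e) : int := pdeg (fun u => Posz (u == v)) x.

Lemma gdegM v x y : gdeg v (x * y) = (gdeg v x + gdeg v y)%R.
Proof. by apply: pdegM => _ [a [b [_ ->]]]; apply: exponent_sum_comm. Qed.

Lemma gdeg_gen v u : gdeg v (g u) = Posz (u == v).
Proof. by apply: pdeg_gen => _ [a [b [_ ->]]]; apply: exponent_sum_comm. Qed.

Lemma gdeg_zpow v x n : gdeg v (zpow x n) = (n * gdeg v x)%R.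
Proof. exact/additive_zpow/gdegM. Qed.

Lemma gdeg_neq1 v x : gdeg v x <> 0%R -> x != 1.
Proof.
by move=> xv; apply/eqP => x1; apply: xv; rewrite x1; apply/additive_one/gdegM.
Qed.

End Raag.

Lemma pact_zpow (A : choiceType) (R : word A -> Prop) (S : Type)
    (act : A * bool -> S -> S) :
    (forall a b s, act (a, b) (act (a, ~~ b) s) = s) ->
    (forall r, R r -> forall s, wact act r s = s) ->
  forall a n s, pact act (zpow (gen R a) n) s
    = ziter (act (a, false)) (act (a, true)) n s.
Proof.
move=> actK actR a n s.
have pactX x m t : pact act (x ^+ m : presented R) t = iter m (pact act x) t.
  by elim: m => [|m IHm]; rewrite ?pact1 // expgS pactM // IHm.
case: n => n /=; first by rewrite pactX; apply: eq_iter => t; rewrite pact_gen.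
rewrite -expVgn pactX -iterS; apply: eq_iter => t; exact: pact_genV.
Qed.

(** Let [x] act on the rational line by [t |-> t + 1], [y] by [t |-> 2 t], and all
    other vertices trivially. Then [X] acts by [t |-> t + m] and [Y] by
    [t |-> q t] with [q <> 1], so that the two products of [X Y] and [Y X] differ
    by the translation by [m (q - 1) ^ 2]. *)
Lemma raag_noncommute (V : finType) (e : rel V) (x y : V) (m n : int) :
  symmetric e -> x != y -> ~~ e x y -> m <> 0%R -> n <> 0%R ->
  let X : raag e := zpow (gen _ x) m in
  let Y : raag e := zpow (gen _ y) n in
  ~ commute (X * Y) (Y * X).
Proof.
move=> e_sym xy exy m0 n0 X Y.
pose act (l : V * bool) (t : rat) : rat :=
  (if l.1 == x then if l.2 then t - 1 else t + 1
   else if l.1 == y then if l.2 then t / 2 else t * 2 else t)%R.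
have actK a b s : act (a, b) (act (a, ~~ b) s) = s.
  rewrite /act /=; case: (a == x); last case: (a == y) => //.
    by case: b; rewrite ?addrK ?subrK.
  by case: b; rewrite ?mulfK ?divfK.
have actR r : raag_relators e r -> forall s, wact act r s = s.
  case=> u [v [euv ->]]; apply: wact_comm => // s /=; rewrite /act /=.
  case: (eqVneq u x) euv => [->|_]; case: (eqVneq v x) => [->|_] //.
  - by case: eqVneq => // ->; rewrite (negbTE exy).
  - by case: eqVneq => // ->; rewrite e_sym (negbTE exy).
  - by case: (u == y); case: (v == y).
have XE t : pact act X t = (t + m%:~R)%R.
  rewrite pact_zpow //.
  have step k s : iter k (act (x, false)) s = (s + k%:R)%R.
    by elim: k => [|k IHk] /=; rewrite ?addr0 // IHk /act eqxx /= -natr1 addrA.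
  have stepV k s : iter k (act (x, true)) s = (s - k%:R)%R.
    by elim: k => [|k IHk] /=; rewrite ?subr0 // IHk /act eqxx /= -natr1 opprD addrA.
  by case: (m) => k; rewrite [LHS](step, stepV) ?NegzE ?mulrNz.
have [q q1 YE] : exists2 q : rat, q <> 1%R & forall t, pact act Y t = (t * q)%R.
  have yx : (y == x) = false by rewrite eq_sym; apply/negbTE.
  have step k s : iter k (act (y, false)) s = (s * 2 ^+ k)%R.
    by elim: k => [|k IHk] /=; rewrite ?mulr1 // IHk /act /= eqxx yx exprSr mulrA.
  have stepV k s : iter k (act (y, true)) s = (s / 2 ^+ k)%R.
    by elim: k => [|k IHk] /=; rewrite ?divr1 // IHk /act /= eqxx yx exprSr invfM mulrA.
  have neq1 k : (2 ^+ k.+1 != 1 :> rat)%R by rewrite Num.Theory.pexpr_eq1.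
  rewrite /Y; clear Y; case: n n0 => [[|k]|k] // _.
    exists (2 ^+ k.+1)%R => [|t]; first exact/eqP.
    by rewrite pact_zpow // [LHS]step.
  exists (2 ^- k.+1)%R => [|t]; first by apply/eqP; rewrite invr_eq1.
  by rewrite pact_zpow // [LHS]stepV.
move=> XY; have : pact act (X * Y * (Y * X)) 0%R = pact act (Y * X * (X * Y)) 0%R.
  by rewrite XY.
rewrite !pactM // !(XE, YE) => E.
have {}E : (m%:~R * (q - 1) ^+ 2 = 0 :> rat)%R by move: E; nra.
move/eqP: E; rewrite mulf_eq0 intr_eq0 expf_eq0 /= subr_eq0.
by case/orP => /eqP.
Qed.

Section NoCycle.
Variables (V : finType) (e : rel V).
Hypotheses (e_sym : symmetric e) (e_irr : irreflexive e).
Variables (phi : raag e -> int) (A : choiceType) (kappa : raag e -> free_group A).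
Hypothesis phiM : forall x y, phi (x * y) = (phi x + phi y)%R.
Hypothesis kappaM : forall x y, phi x = 0%R -> kappa (x * y) = kappa x * kappa y.
Hypothesis kappa_eq1 : forall x, phi x = 0%R -> kappa x = 1 -> x = 1.
Local Notation g v := (gen (raag_relators e) v : raag e).

Let adj_neq x y : e x y -> x != y.
Proof. by apply: contraTneq => ->; rewrite e_irr. Qed.

Let gen_neq1 v : g v != 1.
Proof. by apply: (@gdeg_neq1 _ _ v); rewrite gdeg_gen eqxx. Qed.

(** Commuting elements of the kernel have a common power, which excludes that an
    exponent sum vanishes on only one of them. *)
Lemma kernel_dependent (u v : raag e) w :
    phi u = 0%R -> phi v = 0%R -> commute u v ->
  gdeg w u <> 0%R -> gdeg w v = 0%R -> v = 1.
Proof.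
move=> u0 v0 uv uw vw; apply/eqP; apply/negPn/negP => v1.
have [m [n [m0 /(congr1 (gdeg w))]]] :=
  kernel_common_power phiM kappaM kappa_eq1 u0 v0 (gdeg_neq1 uw) v1 uv.
by rewrite -/(zpow u m) !gdeg_zpow vw mulr0; move: uw; nia.
Qed.

Lemma edge_height v w : e v w -> phi (g v) = 0%R -> phi (g w) <> 0%R.
Proof.
move=> vw v0 w0; case/eqP: (gen_neq1 w).
apply: (kernel_dependent (u := g v) (w := v)) => //; first exact: raag_commute.
  by rewrite gdeg_gen eqxx.
by rewrite gdeg_gen eq_sym (negbTE (adj_neq vw)).
Qed.

(** Three pairwise adjacent vertices generate [Z^3], which meets the kernel in a
    group of rank at least two. *)
Lemma no_triangle x y z : e x y -> e y z -> e x z -> False.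
Proof.
suff tri a b c : phi (g a) <> 0%R -> e a b -> e b c -> e a c -> False.
  move=> xy yz xz; have [x0|/eqP x0] := eqVneq (phi (g x)) 0%R; last exact: tri xy yz xz.
  by apply: (tri y x z) => //; [apply: edge_height xy x0 | rewrite e_sym].
move=> a0 ab bc ac.
(* The part of the subgroup generated by [g v] and [g a] of height 0. *)
pose mix v : raag e := zpow (g v) (phi (g a)) * zpow (g a) (- phi (g v))%R.
have mix0 v : phi (mix v) = 0%R.
  by rewrite phiM !(additive_zpow phiM) mulrC mulNr addrN.
have mixdeg v w : a != w -> gdeg w (mix v) = (phi (g a) * Posz (v == w))%R.
  by move=> /negbTE aw; rewrite gdegM !gdeg_zpow !gdeg_gen aw mulr0 addr0.
have mix1 : mix c = 1.
  apply: (kernel_dependent (u := mix b) (w := b)) => //; rewrite ?mixdeg ?adj_neq //.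
  - have cc u v : e u v -> commute (g u) (g v) by apply: raag_commute.
    apply: commuteM; apply/commute_sym; apply: commuteM; apply: commute_zpow => //.
    + by apply: cc; rewrite e_sym.
    + by apply: cc; rewrite e_sym.
    + by apply: cc.
  - by rewrite eqxx mulr1.
  - by rewrite eq_sym (negbTE (adj_neq bc)) mulr0.
have := mixdeg c c (adj_neq ac).
by rewrite mix1 eqxx mulr1 (additive_one (gdegM _)) => /esym.
Qed.

(** If [x] were in the kernel then powers of its neighbours [a] and [b] would
    generate a free group centralizing [x], and its intersection with the kernel
    is not abelian. *)
Lemma middle_height a x b :
  e a x -> e x b -> a != b -> ~~ e a b -> phi (g x) <> 0%R.
Proof.
move=> ax xb ab nab x0.
have pa : phi (g a) <> 0%R by move=> a0; apply: (edge_height ax).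
have pb : phi (g b) <> 0%R by apply: edge_height xb x0.
pose X : raag e := zpow (g a) (phi (g b)); pose Y : raag e := zpow (g b) (- phi (g a))%R.
have npa : (- phi (g a))%R <> 0%R by lia.
case: (raag_noncommute e_sym ab nab pb npa); rewrite -/X -/Y.
have XY0 : phi X = (- phi Y)%R by rewrite !(additive_zpow phiM); lia.
have xX : commute (g x) X.
  by apply: (@commute_zpow _ (g x) (g a) 1%R); apply/commute_sym/raag_commute.
have xY : commute (g x) Y.
  by apply: (@commute_zpow _ (g x) (g b) 1%R); apply/raag_commute.
apply: (kernel_commute_trans phiM kappaM kappa_eq1 x0 _ _ (gen_neq1 x)).
- by rewrite phiM XY0; lia.
- by rewrite phiM XY0; lia.
- exact: commuteM.
- exact: commuteM.
Qed.

(** A telescoping product: powers [y i] of the vertices of a long cycle, chosen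
    with the same height, give [z i = y i (y i.+1)^-1] in the free kernel, with
    [z 0 ^ m z 1 ^ m ... = 1] for every [m] as consecutive [y i] commute. Since
    consecutive [z i] do not commute, this contradicts [kernel_big_powers]. *)
Lemma no_closed_walk (x : nat -> V) n :
  x n.+1 = x 0 -> (forall i, e (x i) (x i.+1)) ->
  (forall i, x i != x i.+2 /\ ~~ e (x i) (x i.+2)) -> False.
Proof.
move=> xn xe xne; pose p v := phi (g v).
have pS i : p (x i.+1) <> 0%R.
  by have [x02 nx02] := xne i; apply: middle_height x02 nx02.
have px i : p (x i) <> 0%R by case: i => // ; rewrite -xn.
pose E v := (\prod_(u | (p u != 0%R) && (u != v)) p u)%R.
pose N := (\prod_(u | p u != 0%R) p u)%R.
have pE v : p v <> 0%R -> (E v * p v)%R = N.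
  by move=> /eqP v0; rewrite /N (bigD1 v) //= mulrC.
have E0 v : E v <> 0%R.
  by apply/eqP/prodf_neq0 => u /andP[].
pose y i : raag e := zpow (g (x i)) (E (x i)).
have yN i : phi (y i) = N by rewrite (additive_zpow phiM) -(pE _ (px i)).
have yS i : commute (y i) (y i.+1) by apply/commute_zpow/raag_commute.
have y2 i : ~ commute (y i) (y i.+2).
  move=> c; have [x02 nx02] := xne i.
  apply: (raag_noncommute e_sym x02 nx02 (E0 (x i)) (E0 (x i.+2))).
  by rewrite -/(y i) -/(y i.+2) c.
pose z i := y i / y i.+1.
have z0 i : phi (z i) = 0%R by rewrite phiM (additive_inv phiM) !yN addrN.
have zz i : z i * z i.+1 != z i.+1 * z i.
  apply/eqP; rewrite /z => c; apply: (y2 i).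
  have c1 : commute (y i.+1) ((y i.+2)^-1 * y i).
    by apply: commuteM; [apply/commuteV/yS | apply/commute_sym/yS].
  move: c; rewrite !mulgA mulgVK -(mulgA (y i.+1)) c1 mulgK => c.
  by have := @commuteV _ (y i) (y i.+2)^-1 c; rewrite invgK.
have tele m k j : \prod_(i <- iota k j) z i ^+ m = y k ^+ m / y (k + j) ^+ m.
  elim: j k => [|j IHj] k; first by rewrite big_nil addn0 mulgV.
  by rewrite big_cons IHj expgnFl // mulgA mulgVK addSnnS.
have [|||m] := @kernel_big_powers _ _ phiM _ _ kappaM kappa_eq1
  (z 0) [seq z i | i <- iota 1 n].
- apply/allP => u; rewrite -[z 0 :: _]/[seq z i | i <- iota 0 n.+1].
  by move=> /mapP[i _ ->]; apply/eqP.
- by apply: contraTneq (zz 0) => ->; rewrite mul1g mulg1 eqxx.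
- move: (0) => k; elim: n k {xn} => //= n IHn k.
  by rewrite zz IHn.
rewrite -[z 0 :: _]/[seq z i | i <- iota 0 n.+1] big_map tele.
by rewrite add0n /y xn mulgV.
Qed.

End NoCycle.

Lemma nth_rot (T : Type) (x0 : T) (c : seq T) i k :
  i <= size c -> k < size c ->
  nth x0 (rot i c) k = nth x0 c ((i + k) %% size c).
Proof.
move=> ic kc; rewrite /rot nth_cat size_drop nth_drop.
case: ltnP => ck; first by rewrite modn_small //; lia.
rewrite nth_take; last by lia.
have -> : (i + k = k - (size c - i) + size c)%N by lia.
by rewrite modnDr modn_small //; lia.
Qed.

(** A shortest cycle is a triangle or has no chord between vertices at distance
    two. *)
Theorem free_by_cyclic_forest (V : finType) (e : rel V) :
  symmetric e -> irreflexive e -> free_by_cyclic (raag e) -> is_forest e.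
Proof.
move=> e_sym e_irr [A [phi [kappa [phiM kM kI]]]] c.
have [n] := ubnP (size c); elim: n c => // n IHn c cn uc.
rewrite leqNgt; apply/negP => c2.
have [a [b [d [s cE]]]] : exists a b d s, c = [:: a, b, d & s].
  by case: c c2 {cn uc} => [|a [|b [|d s]]] // _; exists a, b, d, s.
have [s0|s0] := eqVneq s [::].
  move: uc; rewrite cE s0 /ucycle /= => /andP[/and4P[ab bd da _] _].
  by apply: (no_triangle e_sym e_irr phiM kM kI ab bd); rewrite e_sym.
pose x i := nth a c (i %% size c).
have rotE i : exists b1 b2 b3 t, [/\ t != [::], rot (i %% size c) c = [:: b1, b2, b3 & t],
    x i = b1, x i.+1 = b2 & x i.+2 = b3].
  have im : i %% size c < size c by rewrite ltn_mod; lia.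
  have xk k : k < size c -> x (i + k) = nth a (rot (i %% size c) c) k.
    by move=> kc; rewrite nth_rot ?modnDml // ltnW.
  have c4 : 3 < size c by rewrite cE; case: s s0 {cE}.
  have := size_rot (i %% size c) c.
  move: (xk 0%N) (xk 1%N) (xk 2%N); rewrite addn0 addn1 addn2.
  case: (rot _ c) => [|b1 [|b2 [|b3 t]]] /= x0 x1 x2 sz; try by lia.
  exists b1, b2, b3, t; split; rewrite ?x0 ?x1 ?x2 //; try by lia.
  by case: t sz {x0 x1 x2} => //= ; lia.
have ucr i : ucycle e (rot i c) by rewrite rot_ucycle.
apply: (@no_closed_walk _ _ e_sym e_irr _ _ _ phiM kM kI x (size c).-1).
- by rewrite prednK ?(ltn_trans _ c2) // /x modnn mod0n.
- move=> i; have [b1 [b2 [b3 [t [_ rE -> -> _]]]]] := rotE i.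
  by have := ucr (i %% size c); rewrite rE => /andP[/andP[]].
- move=> i; have [b1 [b2 [b3 [t [t0 rE -> _ ->]]]]] := rotE i.
  have := ucr (i %% size c); rewrite rE /ucycle => /andP[/= /and3P[b12 b23 p] u].
  move: u; rewrite !inE !negb_or -!andbA => /and5P[_ b13 b1t b23' /andP[b2t b3t]].
  split=> //; apply/negP => e13.
  have sz : size (rot (i %% size c) c) = size c by rewrite size_rot.
  have : size [:: b1, b3 & t] <= 2.
    apply: IHn; first by move: sz cn; rewrite rE /=; lia.
    by rewrite /ucycle /= e13 p !inE !negb_or b13 b1t.
  by case: t t0 {rE p b1t b2t b3t sz}.
Qed.

(** * Embeddings between right-angled Artin groups *)

Section PickGenerator.
Variables (V : finType) (e : rel V).

Definition pick_gen (P : pred V) : raag e :=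
  if [pick v | P v] is Some v then gen _ v else 1.

Lemma pick_gen_unique (P : pred V) v :
  P v -> (forall u, P u -> u = v) -> pick_gen P = gen _ v.
Proof.
by move=> Pv Pu; rewrite /pick_gen; case: pickP => [u /Pu->//|/(_ v)]; rewrite Pv.
Qed.

Lemma pick_gen_commute (P Q : pred V) :
  (forall u v, P u -> Q v -> e u v) -> commute (pick_gen P) (pick_gen Q).
Proof.
rewrite /pick_gen => PQ; case: pickP => [u Pu|_]; last exact/commute_sym/commute1.
case: pickP => [v Qv|_]; last exact/commute1.
exact/raag_commute/PQ.
Qed.

End PickGenerator.

Lemma induced_embeds (V W : finType) (eV : rel V) (eW : rel W) (f : W -> V) :
  injective f -> (forall w w', eW w w' = eV (f w) (f w')) ->
  embeds_in (raag eW) (raag eV).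
Proof.
move=> fI eWE.
pose z v : raag eW := pick_gen eW (fun w => f w == v).
pose act (l : V * bool) (x : raag eW) := if l.2 then (z l.1)^-1 * x else z l.1 * x.
have actK v b x : act (v, b) (act (v, ~~ b) x) = x.
  by case: b; rewrite /act /= ?mulKg ?mulVKg.
have actR r : raag_relators eV r -> forall x, wact act r x = x.
  case=> [x [y [exy ->]]]; apply: wact_comm => // s; rewrite /act /= !mulgA.
  congr (_ * _); apply: pick_gen_commute => u v /eqP ux /eqP vy.
  by rewrite eWE ux vy.
apply: (@embedding_by_action _ _ _ _ (fun w => gen _ (f w)) _ act id) => //.
- move=> r [x [y [exy ->]]]; apply/eval_comm; rewrite !eval_letter.
  by apply: raag_commute; rewrite -eWE.
- move=> w x; rewrite pact_gen // /act /= /z (@pick_gen_unique _ _ _ w) //.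
  by move=> u /eqP/fI.
Qed.

(** The kernel of the map to the integers which kills all generators except [v]
    is the right-angled Artin group of the graph made of one copy of the graph
    minus [v] for each conjugating power of [v], the copies being glued along the
    link of [v]. The vertices [w] of a finite induced subgraph of that graph are
    given by their images [p w] and by the indices [n w] of their copies. The
    kernel acts on [raag eW] through the retraction that kills the other
    vertices, and the whole group acts on [raag eW * int] by the induced
    action. *)
Lemma star_cover (V W : finType) (eV : rel V) (eW : rel W) (v : V)
    (p : W -> V) (n : W -> int) :
    symmetric eV ->
    (forall w, p w != v) ->
    (forall w w', p w = p w' -> eV v (p w) || (n w == n w') -> w = w') ->
    (forall w w', eW w w' =
       eV (p w) (p w') && [|| n w == n w', eV v (p w) | eV v (p w')]) ->
  embeds_in (raag eW) (raag eV).
Proof.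
move=> eV_sym pv pI eWE.
pose copy u i w := (p w == u) && (eV v u || (n w == i)).
pose z u i : raag eW := pick_gen eW (copy u (- i)%R).
pose act (l : V * bool) (s : raag eW * int) :=
  if l.1 == v then (s.1, if l.2 then s.2 - 1 else s.2 + 1)%R
  else (if l.2 then (z l.1 s.2)^-1 * s.1 else z l.1 s.2 * s.1, s.2).
have actK u b s : act (u, b) (act (u, ~~ b) s) = s.
  case: s => x i; rewrite /act /=; case: (u == v) => /=.
    by case: b; rewrite /= ?addrK ?subrK.
  by case: b; rewrite /= ?mulKg ?mulVKg.
have z_link u i j : eV v u -> z u i = z u j.
  move=> vu; rewrite /z /pick_gen.
  by rewrite (@eq_pick _ (copy u (- i)%R) (copy u (- j)%R)) // => w; rewrite /copy vu.
have actR r : raag_relators eV r -> forall s, wact act r s = s.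
  case=> [x [y [exy ->]]]; apply: wact_comm => // -[g i]; rewrite /act /=.
  case: (eqVneq x v) exy => [->|xv] exy; case: (eqVneq y v) exy => [->|yv] exy //=.
  - by rewrite (z_link _ _ i).
  - by rewrite (z_link _ _ i) // eV_sym.
  rewrite !mulgA; congr (_ * _, _); apply: pick_gen_commute => w w'.
  case/andP=> /eqP wx wi /andP[/eqP wy wj]; rewrite eWE wx wy exy /=.
  case/orP: wi => [->|/eqP->]; rewrite ?orbT //.
  by case/orP: wj => [->|/eqP->]; rewrite ?orbT ?eqxx.
pose b : raag eV := gen _ v.
pose img w : raag eV := zpow b (n w) * gen _ (p w) * (zpow b (n w))^-1.
have shift m x i : pact act (zpow b m) (x, i) = (x, i + m)%R.
  rewrite pact_zpow //.
  have step k j : iter k (act (v, false)) (x, j) = (x, j + k%:Z)%R.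
    by elim: k => [|k IHk] /=; rewrite ?addr0 // IHk /act eqxx /=; congr pair; lia.
  have stepV k j : iter k (act (v, true)) (x, j) = (x, j - k%:Z)%R.
    by elim: k => [|k IHk] /=; rewrite ?subr0 // IHk /act eqxx /=; congr pair; lia.
  by case: m => k; rewrite [LHS](step, stepV) ?NegzE.
apply: (@embedding_by_action _ _ _ _ img _ act (fun x => (x, 0%R))) => //.
- by move=> x y [].
- move=> r [x [y [exy ->]]]; apply/eval_comm; rewrite !eval_letter /img.
  move: exy; rewrite eWE => /andP[pxy nxy].
  have {}pxy : commute (gen _ (p x) : raag eV) (gen _ (p y)) by apply: raag_commute.
  have link w m : eV v (p w) -> img w = zpow b m * gen _ (p w) * (zpow b m)^-1.
    move=> vw; have conj1 j : zpow b j * gen _ (p w) * (zpow b j)^-1 = gen _ (p w).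
      by rewrite (@commute_zpow _ b _ j 1%R (raag_commute vw)) mulgK.
    by rewrite /img !conj1.
  case/or3P: nxy => [/eqP nxy|vx|vy].
  - by rewrite nxy; apply: commute_conj.
  - by rewrite -/(img x) (link x (n y)) //; apply: commute_conj.
  - by rewrite -/(img y) (link y (n x)) //; apply: commute_conj.
- move=> w x; rewrite /img !pactM // -zpowV !shift pact_gen // /act.
  rewrite (negbTE (pv w)) /= shift.
  congr pair; last by lia.
  congr (_ * _); rewrite /z (@pick_gen_unique _ _ _ w) //.
    by rewrite /copy eqxx; apply/orP; right; apply/eqP; lia.
  move=> w' /andP[/eqP pw' nw']; apply: pI => //.
  by rewrite pw'; case/orP: nw' => [->//|/eqP ->]; apply/orP; right; apply/eqP; lia.
Qed.

(** * Coronas *)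

(** The corona product with a single vertex: [(x, true)] is a new pendant vertex
    attached to [(x, false)]. *)
Definition corona (V : finType) (e : rel V) : rel (V * bool) := fun x y =>
  if ~~ x.2 && ~~ y.2 then e x.1 y.1 else (x.2 != y.2) && (x.1 == y.1).

Lemma corona_sym (V : finType) (e : rel V) : symmetric e -> symmetric (corona e).
Proof.
by move=> e_sym [x a] [y b]; rewrite /corona /= andbC e_sym (eq_sym a) (eq_sym x).
Qed.

Definition add_leaf (V : finType) (e : rel V) (x : V) : rel (option V) := fun a b =>
  match a, b with
  | Some u, Some v => e u v
  | Some u, None | None, Some u => u == x
  | None, None => false
  end.

(** In the cover of the corona over the link of the pendant vertex of [x], all
    the copies of the corona share exactly [x]. The copies of a neighbour [u] of
    [x] and of its pendant vertex provide the new leaf with its pendant vertex,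
    and another copy of [u] is a pendant vertex for [x] itself. *)
Lemma corona_add_leaf (V : finType) (e : rel V) (x u : V) :
  symmetric e -> irreflexive e -> e x u ->
  embeds_in (raag (corona (add_leaf e x))) (raag (corona e)).
Proof.
move=> e_sym e_irr exu.
have xu : (u == x) = false by apply: contraTF exu => /eqP->; rewrite e_irr.
pose p (w : option V * bool) : V * bool :=
  match w with
  | (Some y, b) => if (y == x) && b then (u, false) else (y, b)
  | (None, b) => (u, b)
  end.
pose n (w : option V * bool) : int :=
  match w with
  | (Some y, b) => if (y == x) && b then 2%R else 0%R
  | (None, b) => 1%R
  end.
have link y : corona e (x, true) y = (y == (x, false)).
  by case: y => y []; rewrite /corona /= xpair_eqE /= ?andbF ?andbT // eq_sym.
apply: (@star_cover _ _ _ _ (x, true) p n).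
- exact: corona_sym.
- case=> [[y|] b]; rewrite /p; last by rewrite xpair_eqE xu.
  by case: (eqVneq y x) => [->|/negbTE yx]; case: b; rewrite /= xpair_eqE ?xu ?yx ?andbF.
- move=> [[y|] [|]] [[y'|] [|]]; rewrite link /p /n ?andbT ?andbF;
    do ?[case: (eqVneq y x) => [->|yx]];
    do ?[case: (eqVneq y' x) => [->|yx']] => //= /(congr1 fst)/= E;
    by [ rewrite E | move: xu; rewrite E eqxx | rewrite xpair_eqE xu
       | rewrite xpair_eqE E xu | rewrite xpair_eqE -E xu ].
- move=> [[y|] [|]] [[y'|] [|]]; rewrite !link /p /n ?andbT ?andbF;
    do ?[case: (eqVneq y x) => [->|yx]]; do ?[case: (eqVneq y' x) => [->|yx']];
    rewrite /corona /= ?xpair_eqE /= ?xu ?e_irr ?eqxx ?andbF ?andbT ?orbF ?orbT //.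
all: rewrite ?(inj_eq Some_inj) ?(eq_sym x) //.
all: try by rewrite e_sym.
all: try by case: (eqVneq y x) => [->|_];
  rewrite ?andbF ?andbT // ?(eq_sym x) ?xu // e_sym exu.
all: try by case: (eqVneq y' x) => [->|_];
  rewrite ?andbF ?andbT // ?xu // e_sym exu.
Qed.

(** * The corona of an edge in [BP3 k] *)

Definition edge_rel : rel bool := fun x y => x != y.

(** The corona of an edge is a path [c0 - a0 - t - a1] on four vertices; with
    [a], [b], [c] the generators of [BP3 k] it embeds by [c0 = c], [a0 = a],
    [t = b^k] and [a1 = b^-1 a b]. These elements lie in the kernel of the map to
    the integers modulo [k] that sends [b] to [1] and [a], [c] to [0]. This kernel
    is a right-angled Artin group generated by [t] and by the conjugates of [a]
    and [c] by powers of [b]. It acts on the group of the path through the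
    retraction that kills all generators but four, and the induced action of
    [BP3 k] is on [k] copies of that group. *)
Lemma corona_edge_embeds k : 2 <= k ->
  embeds_in (raag (corona edge_rel)) (BP3 k).
Proof.
case: k => [|[|k']] // _; set k := k'.+2.
pose P := raag (corona edge_rel).
pose h (x : bool * bool) : P := gen _ x.
pose a0 := h (false, false); pose c0 := h (false, true).
pose t := h (true, false); pose a1 := h (true, true).
pose al (i : 'I_k) : P :=
  if i == 0%N :> nat then a0 else if i == 1%N :> nat then a1 else 1.
pose ce (i : 'I_k) : P := if i == 0%N :> nat then c0 else 1.
pose last_ord : 'I_k := ord_pred ord0.
pose act (l : 'I_3 * bool) (s : P * 'I_k) : P * 'I_k :=
  if l.1 == w0 then (if l.2 then (al s.2)^-1 * s.1 else al s.2 * s.1, s.2)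
  else if l.1 == w1 then
    if l.2 then (if s.2 == ord0 then t^-1 * s.1 else s.1, ord_pred s.2)
    else (if s.2 == last_ord then t * s.1 else s.1, ordS s.2)
  else (if l.2 then (ce s.2)^-1 * s.1 else ce s.2 * s.1, s.2).
have actK x b s : act (x, b) (act (x, ~~ b) s) = s.
  case: s => g i; rewrite /act /=; case: (x == w0) => /=; last case: (x == w1) => /=.
  - by case: b; rewrite /= ?mulKg ?mulVKg.
  - case: b => /=; rewrite ?ordSK ?ord_predK; congr pair.
      rewrite (canF_eq (@ordSK _)) -/last_ord.
      by case: eqP => _; rewrite ?mulKg.
    rewrite /last_ord (inj_eq (can_inj (@ord_predK _))).
    by case: eqP => _; rewrite ?mulVKg.
  - by case: b; rewrite /= ?mulKg ?mulVKg.
have comm x y : corona edge_rel x y -> commute (h x) (h y) by apply: raag_commute.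
have actb n g (i : 'I_k) : n <= k ->
    iter n (act (w1, false)) (g, i)
      = (if k <= i + n then t * g else g, iter n (@ordS k) i).
  elim: n => [|n IHn] nk; first by rewrite addn0 leqNgt ltn_ord.
  rewrite !iterS IHn ?(ltnW nk) // /act /=; congr pair.
  rewrite -(inj_eq val_inj) /= iter_ordS (modn_small (ltnSn _)) addnS.
  have ik := ltn_ord i; case: (leqP k (i + n)) => kin.
    rewrite (leqW kin) -(subnK kin) modnDr modn_small; last by lia.
    by case: eqP => //; lia.
  by rewrite modn_small //; case: eqP => E; case: leqP => //; rewrite /k in kin *; lia.
have ordk (i : 'I_k) : iter k (@ordS k) i = i.
  by apply: val_inj; rewrite [LHS]iter_ordS modnDr modn_small.
have actbk g i : iter k (act (w1, false)) (g, i) = (t * g, i).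
  by rewrite actb // leq_addl ordk.
have wactb n s : wact act (letter_exp w1 n) s = iter n (act (w1, false)) s.
  by elim: n => //= n ->.
have actR r : BP3_relators k r -> forall s, wact act r s = s.
  case=> ->; apply: wact_comm => // -[g i].
    have acta s : wact act (letter w0) s = (al s.2 * s.1, s.2) by [].
    rewrite !wactb !acta !actbk !mulgA; congr (_ * _, _).
    rewrite /al; case: eqP => _; first exact: comm.
    by case: eqP => _; [apply: comm | apply/commute_sym/commute1].
  rewrite /= /act /= !mulgA; congr (_ * _, _); rewrite /al /ce.
  by case: eqP => _; [apply: comm | apply: commute1].
pose g x : BP3 k := gen _ x.
pose img (x : bool * bool) : BP3 k :=
  if x.1 then if x.2 then (g w1)^-1 * g w0 * g w1 else g w1 ^+ k
  else if x.2 then g w2 else g w0.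
have cab := @BP3_commute_ab k'.+1.
have cac := @BP3_commute_ac k'.+1.
apply: (@embedding_by_action _ _ _ _ img _ act (fun x => (x, ord0))) => //.
- by move=> x y [].
- have path4 x y : corona edge_rel x y -> commute (img x) (img y).
    have conj1 : commute (img (true, true)) (img (true, false)).
      have -> : img (true, false) = (g w1)^-1 * g w1 ^+ k * g w1.
        by rewrite -mulgA -expgSr expgS mulKg.
      by have := commute_conj (g w1)^-1 cab; rewrite invgK.
    move: x y => [[] []] [[] []]; rewrite /corona /edge_rel //= => _;
      by apply/commute_sym.
  by move=> r [x [y [exy ->]]]; apply/eval_comm; rewrite !eval_letter; apply: path4.
- have pactb s : pact act (g w1 ^+ k) s = iter k (act (w1, false)) s.
    by rewrite -/(zpow (g w1) k) pact_zpow.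
  have pact_b s : pact act (g w1) s = act (w1, false) s by rewrite pact_gen.
  have pact_bV s : pact act (g w1)^-1 s = act (w1, true) s by rewrite pact_genV.
  have step1 x : act (w1, false) (x, ord0) = (x, ordS ord0).
    by rewrite -[LHS]/(iter 1 (act (w1, false)) _) actb.
  case=> [[] []] x; rewrite -/(h _).
  + rewrite !pactM // pact_b step1 pact_gen //.
    have -> : act (w0, false) (x, ordS ord0) = act (w1, false) (a1 * x, ord0).
      by rewrite step1.
    by rewrite pact_bV (actK w1 true).
  + by rewrite pactb actbk.
  + by rewrite pact_gen // /act.
  + by rewrite pact_gen // /act.
Qed.

Local Close Scope group_scope.

(** * Forests *)

(** A longest simple path starts at such a vertex. *)
Lemma forest_leaf (V : finType) (e : rel V) (x0 : V) :
  symmetric e -> irreflexive e -> is_forest e ->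
  exists y, forall a b, e y a -> e y b -> a = b.
Proof.
move=> e_sym e_irr e_forest.
have [[y leafy]|noleaf] := pselect (exists y, forall a b, e y a -> e y b -> a = b).
  by exists y.
have two y : exists a b, [/\ e y a, e y b & a != b].
  apply: contrapT => no2; apply: noleaf; exists y => a b ya yb.
  by apply/eqP/negPn/negP => ab; apply: no2; exists a, b.
have long n : exists x p, [/\ path e x p, uniq (x :: p) & size p = n].
  elim: n => [|n [x [p [xp up sp]]]]; first by exists x0, [::].
  have [w xw wp] : exists2 w, e x w & w != head x p.
    have [a [b [xa xb ab]]] := two x.
    have [aE|] := eqVneq a (head x p); last by exists a.
    by exists b; rewrite // -aE eq_sym.
  have wx : w != x by apply: contraTneq xw => ->; rewrite e_irr.
  exists w, (x :: p); split; [by rewrite /= e_sym xw| | by rewrite /= sp].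
  rewrite cons_uniq inE negb_or wx /= andbC [_ && uniq p]up /=.
  apply/negP => /splitPr pE; case: pE xp up wp {sp} => p1 p2.
  case: p1 => [|z p1] /=; first by rewrite eqxx.
  rewrite -cat_rcons cat_path mem_cat cat_uniq.
  move=> /andP[xz /andP[zp1 _]] /and3P[].
  rewrite inE mem_cat !negb_or => /and3P[xnz xp1 _] zn /and3P[up1 _ _] _.
  have : size [:: x, z & rcons p1 w] <= 2.
    apply: e_forest; rewrite /ucycle /= rcons_path xz zp1 last_rcons e_sym xw /=.
    rewrite inE negb_or xnz xp1 up1 andbT /=.
    by case/andP: zn => ->.
  by rewrite /= size_rcons.
have [x [p [_ /card_uniqP up sp]]] := long #|V|.
by have := max_card (mem (x :: p)); rewrite up /= sp ltnn.
Qed.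

Lemma is_forest_relpre (V W : finType) (e : rel V) (f : W -> V) :
  injective f -> is_forest e -> is_forest (relpre f e).
Proof.
move=> fI e_forest c /andP[ec uc]; rewrite -(size_map f); apply: e_forest.
by rewrite /ucycle map_inj_uniq // uc andbT cycle_map.
Qed.

(** The absence of isolated vertices is what makes this class of graphs closed
    under the addition of leaves. *)
Definition corona_embeds (G : groupType) (U : finType) (e : rel U) : Prop :=
  [/\ symmetric e, irreflexive e, forall x, exists u, e x u
    & embeds_in (raag (corona e)) G].

Lemma corona_embeds_add_leaf (G : groupType) (U : finType) (e : rel U) (x : U) :
  corona_embeds G e -> corona_embeds G (add_leaf e x).
Proof.
case=> e_sym e_irr e_nbr eG; split.
- by move=> [u|] [v|] //=.
- by move=> [u|] //=.
- case=> [u|]; last by exists (Some x) => /=.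
  by have [v uv] := e_nbr u; exists (Some v).
- have [u xu] := e_nbr x; exact: embeds_in_trans (corona_add_leaf e_sym e_irr xu) eG.
Qed.

(** Remove a vertex with at most one neighbour, embed the rest by induction, and
    put the vertex back as a leaf. *)
Lemma forest_in_corona_embeds (G : groupType) (V : finType) (e : rel V) :
  corona_embeds G edge_rel ->
  symmetric e -> irreflexive e -> is_forest e ->
  exists (U : finType) (eU : rel U) (f : V -> U),
    [/\ corona_embeds G eU, inhabited U, injective f
      & forall x y, e x y = eU (f x) (f y)].
Proof.
move=> G_edge; have [n] := ubnP #|V|.
elim: n V e => // n IHn V e Vn e_sym e_irr e_forest.
have [y0|V0] := pickP V; last first.
  exists bool, edge_rel, (fun _ => true); split=> // [|x|x]; first exact: (inhabits true).
    by have := V0 x.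
  by have := V0 x.
have [y leafy] := forest_leaf (y0 : V) e_sym e_irr e_forest.
pose V' : finType := {x : V | x != y}; pose e' : rel V' := relpre val e.
have [||||U [eU [f [eUG [x0] fI fE]]]] := IHn V' e'.
- have cV : #|V'| = #|V|.-1 by rewrite card_sig -(cardC1 y); apply: eq_card.
  have V_gt0 : 0 < #|V| by apply/card_gt0P; exists y.
  by rewrite cV prednK.
- by move=> a b; apply: e_sym.
- by move=> a; apply: e_irr.
- exact: is_forest_relpre val_inj e_forest.
(* The remaining vertex [y] becomes a leaf attached to some vertex [q]. *)
suff [U1 [e1 [f1 [q [e1G f1I f1E f1q]]]]] :
    exists (U1 : finType) (e1 : rel U1) (f1 : V' -> U1) (q : U1),
    [/\ corona_embeds G e1, injective f1, forall a b, e' a b = e1 (f1 a) (f1 b)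
      & forall a, e y (val a) = (f1 a == q)].
  exists (option U1), (add_leaf e1 q), (fun z => omap f1 (insub z)).
  have outside z : ~~ (z != y) -> z = y by move/negPn/eqP.
  split.
  - exact: corona_embeds_add_leaf.
  - exact: (inhabits None).
  - move=> a b; case: (insubP V' a) => [a' _ <-|/outside->];
      case: (insubP V' b) => [b' _ <-|/outside->] //=.
    by case=> /f1I->.
  - move=> a b; case: (insubP V' a) => [a' _ <-|/outside->];
      case: (insubP V' b) => [b' _ <-|/outside->] //=.
    + exact: f1E.
    + by rewrite e_sym f1q.
    + exact: f1q.
have [x yx|y0'] := pickP (e y).
  have xy : x != y by apply: contraTneq yx => ->; rewrite e_irr.
  pose x' : V' := exist (fun z => z != y) x xy.
  exists U, eU, f, (f x'); split=> // a.
  apply/idP/eqP => [ya|/fI -> //].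
  by congr f; apply: val_inj; apply: leafy ya yx.
(* A path of length three from a vertex of [U] reaches a vertex adjacent to no
   vertex of [U]. *)
exists (option (option U)), (add_leaf (add_leaf eU x0) None),
  (fun a => Some (Some (f a))), None.
split=> [||//|a]; last exact: y0'.
- exact/corona_embeds_add_leaf/corona_embeds_add_leaf.
- by move=> a b [/fI].
Qed.

Lemma embeds_forest (V : finType) (e : rel V) (k : nat) : 2 <= k ->
  symmetric e -> irreflexive e -> is_forest e -> embeds_in (raag e) (BP3 k).
Proof.
move=> k2 e_sym e_irr e_forest.
have edgeG : corona_embeds (BP3 k) edge_rel.
  split; [by case=> -[] | by case | | exact: corona_edge_embeds].
  by move=> x; exists (~~ x); case: x.
have [U [eU [f [[_ _ _ eUG] _ fI fE]]]] :=
  forest_in_corona_embeds edgeG e_sym e_irr e_forest.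
apply: embeds_in_trans eUG; apply: (@induced_embeds _ _ _ _ (fun v => (f v, false))).
  by move=> a b [/fI].
by move=> a b; rewrite fE.
Qed.

Theorem corollary3p12 (k : nat) (V : finType) (e : rel V)
    (hk : 2 <= k) (e_sym : symmetric e) (e_irr : irreflexive e) :
  embeds_in (raag e) (BP3 k) <-> is_forest e.
Proof.
split; last exact: embeds_forest.
move=> eG; apply: (free_by_cyclic_forest e_sym e_irr); apply: free_by_cyclic_sub eG _.
by case: k hk => // k _; apply: BP3_free_by_cyclic.
Qed.
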